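(* Let $A$ be a split weakly basic graded locally bounded algebra with enough idempotents, with weakly basic distinguished family $(e_i)_{i\in I}$, and let $G$ be a group of graded automorphisms of $A$ (of degree $0$, permuting the $e_i$) acting freely on objects. The following assertions are equivalent: 1. $A$ is graded pseudo-Frobenius; 2. $\Lambda=A/G$ is graded pseudo-Frobenius.
   Context: $K$ is a fixed field and $H$ a fixed abelian group, written additively. Algebras are associative $K$-algebras, not necessarily unital. A *graded algebra with enough idempotents* is an $H$-graded algebra $A=\oplus_{h\in H}A_h$ having a family $(e_i)_{i\in I}$ of nonzero orthogonal idempotents, homogeneous of degree $0$, with $\oplus_{i\in I}e_iA=A=\oplus_{i\in I}Ae_i$ (a *distinguished family* ). $A$ is *locally finite dimensional* if $\dim_K e_iA_he_j<\infty$ for all $i,j\in I$, $h\in H$. It is *graded locally bounded* if moreover, for each $(i,h)\in I\times H$, the sets $\{j: e_iA_he_j\neq 0\}$ and $\{j:e_jA_he_i\neq 0\}$ are finite. Modules are unital; $A\text{-}Gr$ (resp. $Gr\text{-}A$) is the category of $H$-graded left (resp. right) $A$-modules with degree $0$ homomorphisms. The graded Jacobson radical $J^{gr}(A)$ is the intersection of all maximal graded left ideals of $A$ (equivalently, of all maximal graded right ideals). A locally finite dimensional graded algebra with enough idempotents is *weakly basic* if it has a distinguished family $(e_i)_{i\in I}$ (called *weakly basic* ) such that each $e_iA_0e_i$ is local and $e_iAe_j\subseteq J^{gr}(A)$ for all $i\neq j$. It is *split* if $e_iA_0e_i/e_iJ(A_0)e_i\cong K$ for each $i$, where $J(A_0)$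 is the Jacobson radical of $A_0$. For graded $K$-vector spaces $V,W$ with finite dimensional homogeneous components, put $D(V)=\oplus_h\mathrm{Hom}_K(V_h,K)$. A bilinear form $V\times W\to K$ is *of degree $d\in H$* if $(V_h,W_k)\neq 0$ implies $h+k=d$; such a form is *nondegenerate* if the induced maps $W\to D(V)$ and $V\to D(W)$ are bijective. A *graded Nakayama form* for a weakly basic $A$ is a bilinear form $(-,-):A\times A\to K$ such that: (i) $(ab,c)=(a,bc)$ for all $a,b,c\in A$; (ii) for each $i\in I$ there is a unique $\nu(i)\in I$ with $(e_iA,Ae_{\nu(i)})\neq 0$, and $\nu:I\to I$ is a bijection; (iii) there is a map $\mathbf h:I\to H$ such that, for all $i,j\in I$, the induced form $e_iAe_j\times e_jAe_{\nu(i)}\to K$ is a nondegenerate graded bilinear form of degree $\mathbf h(i)$. A graded algebra is *graded pseudo-Frobenius* if it is weakly basic (in particular locally finite dimensional) and admits a graded Nakayama form; equivalently, if it is weakly basic and in $A\text{-}Gr$ (resp. $Gr\text{-}A$) the finitely generated projective objects coincide with the finitely cogenerated injective ones. Group action: $G$ acts on $A$ by graded algebra automorphisms of degree $0$ permuting the $e_i$; write $a^g$ for the action of $g$ on $a\in A$ and $g(i)$ for the index with $(e_i)^g=e_{g(i)}$. $G$ *acts freely on objects* if $g(i)\neq i$ for all $i\in I$ and $g\in G\setminus\{1\}$. In that case the *orbit category* (or algebra) $\Lambda=A/G$ is the graded algebra with enough idempotents whose distinguished idempotents $e_{[i]}$ are indexed by the $G$-orbits $[i]$ of $I$; $e_{[i]}\Lambda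 e_{[j]}$ consists of the finite formal sums $\sum_{g\in G}[a_g]$ where $[a_g]$ is the $G$-orbit of an element $a_g\in e_iAe_{g(j)}$ (so $e_{[i]}\Lambda e_{[j]}\cong\oplus_{g\in G}e_iAe_{g(j)}$; this depends only on the orbits $[i],[j]$). For $a\in e_iAe_j$ write $i(a)=i$, $t(a)=j$. Multiplication extends bilinearly the rule $[a][b]=0$ if $[t(a)]\neq[i(b)]$ and $[a][b]=[ab^g]$ if $[t(a)]=[i(b)]$, where $g$ is the unique element of $G$ with $g(i(b))=t(a)$. The degree of $[a]$ is that of $a$. *)

(* Defs.v *)
From HB Require Import structures.
From mathcomp Require Import all_boot all_algebra finmap.
From mathcomp Require Import boolp classical_sets functions cardinality fsbigop.

Set Implicit Arguments.
Unset Strict Implicit.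
Unset Printing Implicit Defensive.

Import GRing.Theory.
Local Open Scope classical_set_scope.
Local Open Scope ring_scope.
Local Open Scope quotient_scope.

Section LinearAlgebra.
Context (K : fieldType) (E : lmodType K).

Definition subspace (U : set E) : Prop :=
  U 0 /\ forall (c : K) u v, U u -> U v -> U (c *: u + v).

Definition fin_dim (U : set E) : Prop :=
  exists s : seq E, (forall x, x \in s -> U x) /\
    forall u, U u ->
      exists c : nat -> K, u = \sum_(i < size s) c i *: s`_i.

(* [\sum_(t \in setT) f t] is the sum over the (finite) support of f *)
Definition decomposition (T : choiceType) (V : T -> set E) (u : E) (f : T -> E)
    : Prop :=
  [/\ forall t, V t (f t), finite_set [set t | f t != 0]
    & u = \sum_(t \in setT) f t].

Definition direct_sum (T : choiceType) (V : T -> set E) : Prop :=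
  forall u, exists! f, decomposition V u f.

End LinearAlgebra.

Record grAlgebra (K : fieldType) (H : zmodType) := GrAlgebra {
  gr_space :> lmodType K;
  gr_mul : {bilinear gr_space -> gr_space -> gr_space};
  gr_comp : H -> set gr_space;
  gr_mulA : associative gr_mul;
  gr_comp_subspace : forall h, subspace (gr_comp h);
  gr_comp_direct : direct_sum gr_comp;
  gr_comp_mul : forall h k a b,
    gr_comp h a -> gr_comp k b -> gr_comp (h + k) (gr_mul a b)
}.

Arguments gr_comp {K H} A : rename.
Notation "a ** b" := (gr_mul _ a b) (at level 40, left associativity).

Section GradedAlgebra.
Context (K : fieldType) (H : zmodType) (A : grAlgebra K H).

(* R is a subalgebra of A, possibly with a unit of its own. When R has enough
   idempotents, its left ideals are automatically K-subspaces. *)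
Definition left_ideal (R M : set A) : Prop :=
  [/\ subspace M, M `<=` R & forall r m, R r -> M m -> M (r ** m)].

Definition graded_left_ideal (M : set A) : Prop :=
  left_ideal setT M /\
  forall a f, M a -> decomposition (gr_comp A) a f -> forall h, M (f h).

Definition maximal_among (P : set A -> Prop) (R M : set A) : Prop :=
  [/\ P M, M <> R & forall N, P N -> N <> R -> M `<=` N -> N = M].

Definition maximal_left_ideal (R : set A) := maximal_among (left_ideal R) R.

Definition maximal_graded_left_ideal := maximal_among graded_left_ideal setT.

(* For R = A_0, which has enough idempotents, this is the Jacobson radical of a
   nonunital ring: maximal left ideals are then regular. *)
Definition jacobson (R : set A) : set A :=
  [set a | R a /\ forall M, maximal_left_ideal R M -> M a].

Definition graded_jacobson : set A :=
  [set a | forall M, maximal_graded_left_ideal M -> M a].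

(* Meaningful when the subalgebra R has a nonzero unit of its own *)
Definition is_local (R : set A) : Prop := exists! M, maximal_left_ideal R M.

Section Family.
Context (I : choiceType) (e : I -> A).

Definition peirce (i j : I) : set A := [set e i ** a ** e j | a in setT].

Definition peirce_comp (i : I) (h : H) (j : I) : set A :=
  [set e i ** a ** e j | a in gr_comp A h].

Definition eA (i : I) : set A := [set e i ** a | a in setT].
Definition Ae (i : I) : set A := [set a ** e i | a in setT].

Record distinguished_family : Prop := DistinguishedFamily {
  df_neq0 : forall i, e i != 0;
  df_deg0 : forall i, gr_comp A 0 (e i);
  df_idem : forall i, e i ** e i = e i;
  df_orth : forall i j, i != j -> e i ** e j = 0;
  df_row : direct_sum eA;
  df_col : direct_sum Ae
}.

Definition locally_finite_dimensional : Prop :=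
  forall i h j, fin_dim (peirce_comp i h j).

Definition graded_locally_bounded : Prop :=
  locally_finite_dimensional /\
  forall i h, finite_set [set j | peirce_comp i h j <> [set 0]] /\
              finite_set [set j | peirce_comp j h i <> [set 0]].

Record weakly_basic_family : Prop := WeaklyBasicFamily {
  wb_distinguished : distinguished_family;
  wb_lfd : locally_finite_dimensional;
  wb_local : forall i, is_local (peirce_comp i 0 i);
  wb_radical : forall i j, i != j -> peirce i j `<=` graded_jacobson
}.

(* e_i A_0 e_i / e_i J(A_0) e_i is isomorphic to K as an algebra: there is a
   unital algebra morphism chi from e_i A_0 e_i to K with kernel
   e_i J(A_0) e_i; it is onto since it maps e_i to 1. *)
Definition split_family : Prop :=
  forall i, exists chi : A -> K, let R := peirce_comp i 0 i in
  [/\ forall (c : K) x y, R x -> R y -> chi (c *: x + y) = c * chi x + chi y,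
      forall x y, R x -> R y -> chi (x ** y) = chi x * chi y,
      chi (e i) = 1
    & forall x, R x ->
        (chi x = 0 <->
         [set e i ** a ** e i | a in jacobson (gr_comp A 0)] x)].

(* For a graded subspace V, the space D(V) = \bigoplus_h Hom(V_h, K) consists
   of the linear forms on V vanishing on all but finitely many V_h. Such a form
   is represented by a function on A, of which only the values on V matter. *)
Definition graded_dual (V : set A) (phi : A -> K) : Prop :=
  (forall (c : K) u v, V u -> V v -> phi (c *: u + v) = c * phi u + phi v) /\
  finite_set [set h | exists2 v, (V `&` gr_comp A h) v & phi v != 0].

Definition bijects_onto_dual (W V : set A) (B : A -> A -> K) : Prop :=
  (forall w, W w -> graded_dual V (B w)) /\
  (forall phi, graded_dual V phi ->
     exists! w, W w /\ forall v, V v -> B w v = phi v).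

Definition nondegenerate (V W : set A) (B : A -> A -> K) : Prop :=
  bijects_onto_dual W V (fun w v => B v w) /\ bijects_onto_dual V W B.

Definition form_of_degree (V W : set A) (B : A -> A -> K) (d : H) : Prop :=
  forall h k v w, (V `&` gr_comp A h) v -> (W `&` gr_comp A k) w ->
    B v w != 0 -> h + k = d.

Definition graded_nakayama_form (B : {biscalar A}) : Prop :=
  (forall a b c, B (a ** b) c = B a (b ** c)) /\
  exists nu : I -> I,
  [/\ bijective nu,
      forall i j,
        (exists a b, [/\ eA i a, Ae j b & B a b != 0]) <-> j = nu i
    & exists deg : I -> H, forall i j,
        nondegenerate (peirce i j) (peirce j (nu i)) B /\
        form_of_degree (peirce i j) (peirce j (nu i)) B (deg i)].

End Family.

Definition graded_pseudo_Frobenius : Prop :=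
  exists (I : choiceType) (e : I -> A), weakly_basic_family e /\
  exists B : {biscalar A}, graded_nakayama_form e B.

End GradedAlgebra.

(* a^g is [gact X g a] and g(i) is [gobj X g i]; it is a left action:
   a^(gh) = (a^h)^g. Since the e_i are distinct, gobj is determined by gact. *)
Record graded_action (K : fieldType) (H : zmodType) (A : grAlgebra K H)
    (I : choiceType) (e : I -> A) (G : groupType) := GradedAction {
  gact : G -> {linear A -> A};
  gobj : G -> I -> I;
  gact1 : forall a, gact 1%g a = a;
  gactM : forall g h a, gact (g * h)%g a = gact g (gact h a);
  gact_mul : forall g a b, gact g (a ** b) = gact g a ** gact g b;
  gact_comp : forall g h a, gr_comp A h a -> gr_comp A h (gact g a);
  gact_e : forall g i, gact g (e i) = e (gobj g i)
}.

Definition acts_freely (K : fieldType) (H : zmodType) (A : grAlgebra K H)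
    (I : choiceType) (e : I -> A) (G : groupType)
    (X : graded_action e G) : Prop :=
  forall g i, g != 1%g -> gobj X g i <> i.

Section Fsum.
Context (V : zmodType).

Lemma fsumE (T : choiceType) (X : {fset T}) (f : T -> V) :
  (forall t, f t != 0 -> t \in X) -> \sum_(t \in setT) f t = \sum_(t <- X) f t.
Proof.
by move=> fX; apply: fsbigTE => t; apply: contraNeq; apply: fX.
Qed.

Lemma finsupp_fset (T : choiceType) (P : set T) :
  finite_set P -> exists X : {fset T}, forall t, P t -> t \in X.
Proof. by move=> /finite_fsetP[X ->]; exists X. Qed.

Lemma fsum_morph (W : zmodType) (T : choiceType) (phi : V -> W) (f : T -> V) :
  phi 0 = 0 -> {morph phi : x y / x + y} ->
  finite_set [set t | f t != 0] ->
  phi (\sum_(t \in setT) f t) = \sum_(t \in setT) phi (f t).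
Proof.
move=> phi0 phiD /finsupp_fset[X fX].
rewrite !(@fsbigTE _ _ _ _ X).
- by rewrite (big_morph phi phiD phi0).
- move=> t; apply: contraNeq => pf; apply: fX => /=.
  by apply: contra_neq pf => ->.
- by move=> t; apply: contraNeq; apply: fX.
Qed.

Lemma fsumD (T : choiceType) (f g : T -> V) :
  finite_set [set t | f t != 0] -> finite_set [set t | g t != 0] ->
  \sum_(t \in setT) (f t + g t) =
  \sum_(t \in setT) f t + \sum_(t \in setT) g t.
Proof.
move=> /finsupp_fset[X fX] /finsupp_fset[Y gY].
have fXY t : f t != 0 -> t \in (X `|` Y)%fset.
  by move=> /fX tX; rewrite inE tX.
have gXY t : g t != 0 -> t \in (X `|` Y)%fset.
  by move=> /gY tY; rewrite inE tY orbT.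
rewrite !(@fsumE _ (X `|` Y)%fset) ?big_split // => t.
by have [->|/fXY//] := eqVneq (f t) 0; rewrite add0r; apply: gXY.
Qed.

Lemma exchange_fsum (S T : choiceType) (F : S -> T -> V) :
  finite_set [set p : S * T | F p.1 p.2 != 0] ->
  \sum_(s \in setT) \sum_(t \in setT) F s t =
  \sum_(t \in setT) \sum_(s \in setT) F s t.
Proof.
move=> /finsupp_fset[Z FZ].
pose X := [fset p.1 | p in Z]%fset; pose Y := [fset p.2 | p in Z]%fset.
have FX s t : F s t != 0 -> s \in X.
  by move=> nz; apply/imfsetP; exists (s, t) => //=; apply: FZ.
have FY s t : F s t != 0 -> t \in Y.
  by move=> nz; apply/imfsetP; exists (s, t) => //=; apply: FZ.
rewrite (@fsumE _ X); last first.
  move=> s; apply: contraNT => sX; rewrite fsbig1 // => t _.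
  by apply: contraNeq sX => /FX.
rewrite (@fsumE _ Y); last first.
  move=> t; apply: contraNT => tY; rewrite fsbig1 // => s _.
  by apply: contraNeq tY => /FY.
under eq_bigr => s _ do rewrite (@fsumE _ Y _ (FY s)).
rewrite exchange_big; apply: eq_bigr => t _.
by rewrite (@fsumE _ X _ (FX ^~ t)).
Qed.

End Fsum.

Section Decomposition.
Context (K : fieldType) (E : lmodType K) (T : choiceType) (V : T -> set E).
Hypothesis V_subspace : forall t, subspace (V t).

Lemma decomposition_lin (c : K) u v f g :
  decomposition V u f -> decomposition V v g ->
  decomposition V (c *: u + v) (fun t => c *: f t + g t).
Proof.
move=> [fV ff ->] [gV gf ->].
have cff : finite_set [set t | c *: f t != 0].
  apply: sub_finite_set ff => t /=; apply: contra_neq => ->.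
  by rewrite scaler0.
split.
- by move=> t; apply: (V_subspace t).2.
- apply: sub_finite_set (_ : finite_set ([set t | c *: f t != 0] `|` [set t | g t != 0])).
    move=> t /=; have [->|cf0 _] := eqVneq (c *: f t) 0; last by left.
    by rewrite add0r; right.
  by rewrite finite_setU.
- rewrite fsumD //; congr (_ + _).
  by rewrite (fsum_morph (phi := fun x => c *: x)) ?scaler0 // => x y; rewrite scalerDr.
Qed.

End Decomposition.

Section MulTheory.
Context (K : fieldType) (H : zmodType) (A : grAlgebra K H).
Implicit Types a b c : A.

Lemma gmulDl a b c : (a + b) ** c = a ** c + b ** c.
Proof. exact: linearDl. Qed.
Lemma gmulDr a b c : a ** (b + c) = a ** b + a ** c.
Proof. exact: linearDr. Qed.
Lemma gmul0l a : 0 ** a = 0 :> A. Proof. exact: linear0l. Qed.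
Lemma gmul0r a : a ** 0 = 0 :> A. Proof. exact: linear0r. Qed.
Lemma gmulZl (k : K) a b : (k *: a) ** b = k *: (a ** b).
Proof. exact: linearZl_LR. Qed.
Lemma gmulZr (k : K) a b : a ** (k *: b) = k *: (a ** b).
Proof. exact: linearZr_LR. Qed.
Lemma gmul_suml (T : Type) (s : seq T) (F : T -> A) b :
  (\sum_(i <- s) F i) ** b = \sum_(i <- s) F i ** b.
Proof.
elim/big_ind2: _ => [|x1 x2 y1 y2 <- <-|//]; by rewrite ?gmulDl ?gmul0l.
Qed.
Lemma gmul_sumr (T : Type) (s : seq T) (F : T -> A) a :
  a ** (\sum_(i <- s) F i) = \sum_(i <- s) a ** F i.
Proof.
elim/big_ind2: _ => [|x1 x2 y1 y2 <- <-|//]; by rewrite ?gmulDr ?gmul0r.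
Qed.

Lemma hcomp_ex a : exists f, decomposition (gr_comp A) a f.
Proof. by have [f [fP _]] := gr_comp_direct a; exists f. Qed.

Definition hcomp a : H -> A := projT1 (cid (hcomp_ex a)).

Lemma hcompP a : decomposition (gr_comp A) a (hcomp a).
Proof. exact: (projT2 (cid (hcomp_ex a))). Qed.

Lemma hcomp_uniq a f : decomposition (gr_comp A) a f -> hcomp a = f.
Proof.
have [f0 [_ f0U]] := gr_comp_direct a.
by move=> fP; rewrite -(f0U _ fP) -(f0U _ (hcompP a)).
Qed.

Lemma hcomp_lin (k : K) a b h :
  hcomp (k *: a + b) h = k *: hcomp a h + hcomp b h.
Proof.
have := decomposition_lin (@gr_comp_subspace _ _ A) k (hcompP a) (hcompP b).
by move=> /hcomp_uniq ->.
Qed.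

Lemma hcompD a b h : hcomp (a + b) h = hcomp a h + hcomp b h.
Proof. by have := hcomp_lin 1 a b h; rewrite !scale1r. Qed.

Lemma hcomp0 h : hcomp 0 h = 0.
Proof. by apply: (@addIr _ (hcomp 0 h)); rewrite -hcompD !add0r. Qed.

Lemma hcompB a b h : hcomp (a - b) h = hcomp a h - hcomp b h.
Proof. by rewrite addrC -scaleN1r hcomp_lin scaleN1r addrC. Qed.

Lemma hcomp_sum (T : Type) (s : seq T) (F : T -> A) h :
  hcomp (\sum_(i <- s) F i) h = \sum_(i <- s) hcomp (F i) h.
Proof.
elim/big_ind2: _ => [|x1 x2 y1 y2 <- <-|//]; by rewrite ?hcompD ?hcomp0.
Qed.

End MulTheory.

Section OrbitAlgebra.
Context (K : fieldType) (H : zmodType) (A : grAlgebra K H).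
Context (I : choiceType) (e : I -> A) (G : groupType).
Context (X : graded_action e G).
Implicit Types (a b c : A) (g h : G).

Definition orbit_null a : Prop :=
  exists s : seq (G * A), a = \sum_(p <- s) (gact X p.1 p.2 - p.2).

Definition orbit_null_pred : {pred A} := [pred a | `[< orbit_null a >]].

Lemma orbit_nullP a : reflect (orbit_null a) (a \in orbit_null_pred).
Proof. by rewrite inE; exact: asboolP. Qed.

Lemma orbit_null_closed : zmod_closed orbit_null_pred.
Proof.
split; first by apply/orbit_nullP; exists [::]; rewrite big_nil.
move=> _ _ /orbit_nullP[s ->] /orbit_nullP[t ->]; apply/orbit_nullP.
exists (s ++ [seq (p.1, - p.2) | p <- t]).
rewrite big_cat big_map; congr (_ + _).
by rewrite (big_morph _ (@opprD _) (@oppr0 _)); apply: eq_bigr => p _ /=;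
  rewrite linearN opprB opprK addrC.
Qed.

HB.instance Definition _ :=
  GRing.isZmodClosed.Build A orbit_null_pred orbit_null_closed.

(* Since A is the direct sum of the e_i A e_j, the finite formal sums of
   orbits [a] of elements a of the e_i A e_j form the quotient of A by the
   relations [a^g] = [a]. By orbit_class_inj below, when the action is free no
   further identification takes place inside e_i A, which is the direct sum of
   the e_i A e_j over all j. *)
Definition orbit_space : Type := Quotient.quot orbit_null_pred.

HB.instance Definition _ := GRing.Zmodule.on orbit_space.

Definition orbit_class a : orbit_space := \pi_(Quotient.quot orbit_null_pred) a.

Lemma orbit_classP a b : orbit_class a = orbit_class b <-> orbit_null (a - b).
Proof.
rewrite /orbit_class; split.
  by move=> /eqP; rewrite -Quotient.idealrBE => /orbit_nullP.
by move=> /orbit_nullP ab; apply/eqP; rewrite -Quotient.idealrBE.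
Qed.

Lemma orbit_class_surj (x : orbit_space) : exists a, x = orbit_class a.
Proof. by exists (repr x); rewrite /orbit_class reprK. Qed.

Lemma orbit_classB : {morph orbit_class : a b / a - b}.
Proof. by move=> a b; exact: (raddfB (\pi_(Quotient.quot orbit_null_pred))). Qed.

HB.instance Definition _ :=
  GRing.isZmodMorphism.Build A orbit_space orbit_class orbit_classB.

Lemma orbit_class_act g a : orbit_class (gact X g a) = orbit_class a.
Proof.
by apply/orbit_classP; exists [:: (g, a)]; rewrite big_cons big_nil addr0.
Qed.

Lemma orbit_nullZ (k : K) a : orbit_null a -> orbit_null (k *: a).
Proof.
move=> [s ->]; exists [seq (p.1, k *: p.2) | p <- s].
rewrite big_map scaler_sumr; apply: eq_bigr => p _ /=.
by rewrite linearZ scalerBr.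
Qed.

Definition orbit_scale (k : K) (x : orbit_space) : orbit_space :=
  orbit_class (k *: repr x).

Lemma orbit_scaleE (k : K) a :
  orbit_scale k (orbit_class a) = orbit_class (k *: a).
Proof.
apply/orbit_classP; rewrite -scalerBr; apply: orbit_nullZ.
by apply/orbit_classP; rewrite /orbit_class reprK.
Qed.

Lemma orbit_scaleA k l x : orbit_scale k (orbit_scale l x) = orbit_scale (k * l) x.
Proof. by have [a ->] := orbit_class_surj x; rewrite !orbit_scaleE scalerA. Qed.

Lemma orbit_scale1 : left_id 1 orbit_scale.
Proof.
by move=> x; have [a ->] := orbit_class_surj x; rewrite orbit_scaleE scale1r.
Qed.

Lemma orbit_scaleDr : right_distributive orbit_scale +%R.
Proof.
move=> k x y; have [[a ->] [b ->]] := (orbit_class_surj x, orbit_class_surj y).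
by rewrite -raddfD !orbit_scaleE -raddfD scalerDr.
Qed.

Lemma orbit_scaleDl x : {morph orbit_scale^~ x : k l / k + l}.
Proof.
by move=> k l; have [a ->] := orbit_class_surj x;
  rewrite !orbit_scaleE -raddfD scalerDl.
Qed.

HB.instance Definition _ := GRing.Zmodule_isLmodule.Build K orbit_space
  orbit_scaleA orbit_scale1 orbit_scaleDr orbit_scaleDl.

Lemma orbit_classZ (k : K) a : orbit_class (k *: a) = k *: orbit_class a.
Proof. by rewrite -orbit_scaleE. Qed.

HB.instance Definition _ :=
  GRing.isScalable.Build K A orbit_space *:%R orbit_class orbit_classZ.

(* [a][b] is the sum over g of the [a b^g]. If a is in e_i A e_j and b in
   e_k A e_l, then a b^g = 0 unless g(k) = j: see orbit_mul_peirce and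
   orbit_mul_peirce0 below. *)
Definition twisted_mul a b : A := \sum_(g \in setT) a ** gact X g b.

Definition orbit_mul (x y : orbit_space) : orbit_space :=
  orbit_class (twisted_mul (repr x) (repr y)).

Definition orbit_comp (d : H) : set orbit_space :=
  [set orbit_class a | a in gr_comp A d].

Lemma gact0 g : gact X g 0 = 0. Proof. exact: linear0. Qed.

Lemma gactK g a : gact X g (gact X g^-1%g a) = a.
Proof. by rewrite -gactM mulgV gact1. Qed.

Section Free.
Hypotheses (eD : distinguished_family e) (X_free : acts_freely X).

Lemma df_inj : injective e.
Proof.
move=> i j eij; apply/eqP; apply: contraT => /(df_orth eD).
by rewrite -eij (df_idem eD) => /eqP; rewrite (negPf (df_neq0 eD i)).
Qed.

Lemma gobj1 i : gobj X 1%g i = i.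
Proof. by apply: df_inj; rewrite -gact_e gact1. Qed.

Lemma gobjM g h i : gobj X (g * h)%g i = gobj X g (gobj X h i).
Proof. by apply: df_inj; rewrite -!gact_e gactM. Qed.

Lemma gobj_free g h i : gobj X g i = gobj X h i -> g = h.
Proof.
move=> gh; apply/eqP; apply: contraT => ngh.
have hg1 : (h^-1 * g)%g != 1%g.
  apply: contra_neq ngh => hg1.
  by rewrite -[RHS]mulg1 -hg1 mulgA mulgV mul1g.
case: (X_free hg1 (i := i)).
by rewrite gobjM gh -gobjM mulVg gobj1.
Qed.

Lemma gmul_eA_Ae i j k l a b :
  (e i ** a ** e j) ** (e k ** b ** e l) != 0 -> j = k.
Proof.
apply: contraNeq => /(df_orth eD) jk.
by rewrite !gr_mulA -(gr_mulA (_ ** a)) jk gmul0r !gmul0l.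
Qed.

Lemma row_sum a : exists (Y : {fset I}) (f : I -> A),
  a = \sum_(i <- Y) e i ** f i.
Proof.
have [f [[fV ff ->] _]] := df_row eD a.
have /choice[f' f'E] : forall i, exists b, e i ** b = f i.
  by move=> i; have [b _ <-] := fV i; exists b.
have [Y fY] := finsupp_fset ff; exists Y, f'.
by rewrite (fsumE fY); apply: eq_bigr => i _; rewrite f'E.
Qed.

Lemma col_sum a : exists (Y : {fset I}) (f : I -> A),
  a = \sum_(i <- Y) f i ** e i.
Proof.
have [f [[fV ff ->] _]] := df_col eD a.
have /choice[f' f'E] : forall i, exists b, b ** e i = f i.
  by move=> i; have [b _ <-] := fV i; exists b.
have [Y fY] := finsupp_fset ff; exists Y, f'.
by rewrite (fsumE fY); apply: eq_bigr => i _; rewrite f'E.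
Qed.

Lemma twisted_mul_fin a b : finite_set [set g | a ** gact X g b != 0].
Proof.
have [Y [f ->]] := col_sum a; have [Z [f' ->]] := row_sum b.
pose F (p : I * I) : G := xget 1%g [set g | gobj X g p.2 = p.1].
apply: sub_finite_set
  (finite_image F (finite_setX (finite_fset Y) (finite_fset Z))) => g /= nz.
suff [j [k [jY kZ gkj]]] : exists j k, [/\ j \in Y, k \in Z & gobj X g k = j].
  exists (j, k) => //=; rewrite /F /=; case: xgetP => [h _ /= hkj|/(_ g)//].
  by apply: (@gobj_free _ _ k); rewrite hkj gkj.
apply: contrapT => none; move/negP: nz; apply; apply/eqP.
rewrite gmul_suml big_seq big1 // => j jY.
rewrite linear_sum gmul_sumr big_seq big1 // => k kZ.
rewrite gact_mul gact_e gr_mulA -(gr_mulA (f j)) (df_orth eD) ?gmul0r ?gmul0l //.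
by apply/eqP => jgk; apply: none; exists j, k.
Qed.

Lemma twisted_mul_linl b (k : K) a a' :
  twisted_mul (k *: a + a') b = k *: twisted_mul a b + twisted_mul a' b.
Proof.
rewrite /twisted_mul (fsum_morph (phi := fun x => k *: x)) ?scaler0 //.
- rewrite -fsumD.
  + by apply: eq_fsbigr => g _; rewrite gmulDl gmulZl.
  + apply: sub_finite_set (twisted_mul_fin a b) => g /=.
    by apply: contra_neq => ->; rewrite scaler0.
  + exact: twisted_mul_fin.
- by move=> x y; rewrite scalerDr.
- exact: twisted_mul_fin.
Qed.

Lemma twisted_mul_linr a (k : K) b b' :
  twisted_mul a (k *: b + b') = k *: twisted_mul a b + twisted_mul a b'.
Proof.
rewrite /twisted_mul (fsum_morph (phi := fun x => k *: x)) ?scaler0 //.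
- rewrite -fsumD.
  + by apply: eq_fsbigr => g _; rewrite linearP gmulDr gmulZr.
  + apply: sub_finite_set (twisted_mul_fin a b) => g /=.
    by apply: contra_neq => ->; rewrite scaler0.
  + exact: twisted_mul_fin.
- by move=> x y; rewrite scalerDr.
- exact: twisted_mul_fin.
Qed.

Lemma twisted_mul_is_bilinear : bilinear_for *:%R *:%R twisted_mul.
Proof.
by split=> [b k a a'|a k b b']; [exact: twisted_mul_linl|exact: twisted_mul_linr].
Qed.

HB.instance Definition _ :=
  bilinear_isBilinear.Build K A A A *:%R *:%R twisted_mul twisted_mul_is_bilinear.

Lemma bij_mulg h : bijective (fun g => g * h)%g.
Proof.
by exists (fun g => g * h^-1)%g => g; rewrite -mulgA ?mulgV ?mulVg mulg1.
Qed.

Lemma bij_mulVg h : bijective (fun g => h * g)%g.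
Proof.
by exists (fun g => h^-1 * g)%g => g; rewrite mulgA ?mulgV ?mulVg mul1g.
Qed.

Lemma twisted_mul_actr h a b : twisted_mul a (gact X h b) = twisted_mul a b.
Proof.
rewrite /twisted_mul [RHS](reindex_fsbigT _ _ (bij_mulg h)).
by apply: eq_fsbigr => g _; rewrite gactM.
Qed.

Lemma twisted_mul_actl h a b :
  twisted_mul (gact X h a) b = gact X h (twisted_mul a b).
Proof.
rewrite /twisted_mul (fsum_morph (phi := gact X h)) ?gact0 //.
- rewrite (reindex_fsbigT _ _ (bij_mulVg h)).
  by apply: eq_fsbigr => g _; rewrite gact_mul gactM.
- by move=> x y; rewrite linearD.
- exact: twisted_mul_fin.
Qed.

Lemma twisted_mul_nulll a b : orbit_null a -> orbit_null (twisted_mul a b).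
Proof.
move=> [s ->]; exists [seq (p.1, twisted_mul p.2 b) | p <- s].
rewrite linear_sumlz big_map; apply: eq_bigr => p _ /=.
by rewrite linearBl /= twisted_mul_actl.
Qed.

Lemma twisted_mul_nullr a b : orbit_null b -> twisted_mul a b = 0.
Proof.
move=> [s ->]; rewrite linear_sumr big1 // => p _.
by rewrite linearBr /= twisted_mul_actr subrr.
Qed.

Lemma orbit_mulE a b :
  orbit_mul (orbit_class a) (orbit_class b) = orbit_class (twisted_mul a b).
Proof.
have repr_null c : orbit_null (repr (orbit_class c) - c).
  by apply/orbit_classP; rewrite {1}/orbit_class reprK.
rewrite /orbit_mul; apply/orbit_classP.
set a' := repr (orbit_class a); set b' := repr (orbit_class b).
have -> : twisted_mul a' b' = twisted_mul a' b.
  by apply/eqP; rewrite -subr_eq0 -linearBr /= twisted_mul_nullr //; exact: repr_null.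
rewrite -linearBl; apply: twisted_mul_nulll; exact: repr_null.
Qed.

Lemma orbit_mul_is_bilinear : bilinear_for *:%R *:%R orbit_mul.
Proof.
split=> [z k x y|z k x y]; have [a ->] := orbit_class_surj x;
  have [b ->] := orbit_class_surj y; have [c ->] := orbit_class_surj z.
  by rewrite -linearP !orbit_mulE linearPl linearP.
by rewrite -linearP !orbit_mulE linearPr linearP.
Qed.

HB.instance Definition _ := bilinear_isBilinear.Build K
  orbit_space orbit_space orbit_space *:%R *:%R orbit_mul orbit_mul_is_bilinear.

Lemma twisted_mulA : associative twisted_mul.
Proof.
move=> a b c; apply/esym; rewrite {1}/twisted_mul.
transitivity (\sum_(h \in setT) \sum_(g \in setT)
   a ** gact X g b ** gact X h c).
  apply: eq_fsbigr => h _.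
  rewrite (fsum_morph (phi := fun x => x ** gact X h c)) ?gmul0l //.
    by move=> x y; rewrite gmulDl.
  exact: twisted_mul_fin.
rewrite -exchange_fsum.
  apply: eq_fsbigr => g _.
  rewrite /twisted_mul (fsum_morph (phi := gact X g)) ?gact0 //.
  - rewrite (fsum_morph (phi := gr_mul A a)) ?gmul0r //.
    + rewrite (reindex_fsbigT _ _ (bij_mulVg g)).
      by apply: eq_fsbigr => h _; rewrite gact_mul gactM gr_mulA.
    + by move=> x y; rewrite gmulDr.
    + apply: sub_finite_set (twisted_mul_fin b c) => h /=.
      by apply: contra_neq => ->; rewrite gact0.
  - by move=> x y; rewrite linearD.
  - exact: twisted_mul_fin.
have [Y YP] := finsupp_fset (twisted_mul_fin a b).
have fin : finite_set (\bigcup_(g in [set` Y])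
    [set (g, h) | h in [set h | a ** gact X g b ** gact X h c != 0]]).
  apply: bigcup_finite; first exact: finite_fset.
  by move=> g _; apply/finite_image/twisted_mul_fin.
apply: sub_finite_set fin => -[g h] /= nz; exists g; last by exists h.
by apply: YP; apply: contra_neq nz => ->; rewrite gmul0l.
Qed.

Lemma orbit_mulA : associative orbit_mul.
Proof.
move=> x y z; have [a ->] := orbit_class_surj x;
  have [b ->] := orbit_class_surj y; have [c ->] := orbit_class_surj z.
by rewrite !orbit_mulE twisted_mulA.
Qed.

Lemma orbit_comp_subspace d : subspace (orbit_comp d).
Proof.
have [c0 cl] := @gr_comp_subspace _ _ A d; split.
  by exists 0 => //; rewrite linear0.
move=> k _ _ [a ad <-] [b bd <-]; exists (k *: a + b); first exact: cl.
by rewrite linearP.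
Qed.

Lemma fsum_gr_comp (T : choiceType) (F : T -> A) d :
  (forall t, gr_comp A d (F t)) -> gr_comp A d (\sum_(t \in setT) F t).
Proof.
have [c0 cl] := @gr_comp_subspace _ _ A d => Fd.
elim: (finite_support _ _ _) => [|t s IH]; first by rewrite big_nil.
by rewrite big_cons -[F t]scale1r; apply: cl.
Qed.

Lemma orbit_comp_mul d d' x y :
  orbit_comp d x -> orbit_comp d' y -> orbit_comp (d + d') (orbit_mul x y).
Proof.
move=> [a ad <-] [b bd <-]; exists (twisted_mul a b); last by rewrite orbit_mulE.
by apply: fsum_gr_comp => g; apply: gr_comp_mul => //; apply: gact_comp.
Qed.

Lemma hcomp_act g a d : hcomp (gact X g a) d = gact X g (hcomp a d).
Proof.
have [fA ff fE] := hcompP a.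
suff /hcomp_uniq -> :
  decomposition (gr_comp A) (gact X g a) (fun d => gact X g (hcomp a d)) by [].
split; first by move=> h; apply: gact_comp.
  by apply: sub_finite_set ff => h /=; apply: contra_neq => ->; rewrite gact0.
rewrite [in LHS]fE (fsum_morph (phi := gact X g)) ?gact0 //.
by move=> x y; rewrite linearD.
Qed.

Lemma orbit_null_hcomp a d : orbit_null a -> orbit_null (hcomp a d).
Proof.
move=> [s ->]; exists [seq (p.1, hcomp p.2 d) | p <- s].
rewrite hcomp_sum big_map; apply: eq_bigr => p _ /=.
by rewrite hcompB hcomp_act.
Qed.

Lemma orbit_comp_decomp a :
  decomposition orbit_comp (orbit_class a) (fun d => orbit_class (hcomp a d)).
Proof.
have [fA ff fE] := hcompP a; split.
- by move=> d; exists (hcomp a d).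
- by apply: sub_finite_set ff => d /=; apply: contra_neq => ->; rewrite linear0.
- rewrite [in LHS]fE (fsum_morph (phi := orbit_class)) ?linear0 //.
  by move=> x y; rewrite linearD.
Qed.

Lemma orbit_comp_direct : direct_sum orbit_comp.
Proof.
move=> x; have [a xa] := orbit_class_surj x.
exists (fun d => orbit_class (hcomp a d)); split.
  by rewrite xa; apply: orbit_comp_decomp.
move=> f [fV ff fE]; apply: funext => d.
have /choice[l lP] : forall t, exists b,
    [/\ gr_comp A t b, orbit_class b = f t & f t = 0 -> b = 0].
  move=> t; have [ft0|ft0] := eqVneq (f t) 0.
    exists 0; split=> //; last by rewrite linear0.
    by have [] := @gr_comp_subspace _ _ A t.
  by have [b bt bE] := fV t; exists b; split=> // b0; rewrite b0 eqxx in ft0.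
have lf : finite_set [set t | l t != 0].
  by apply: sub_finite_set ff => t /=; apply: contra_neq; have [] := lP t.
have lE : hcomp (\sum_(t \in setT) l t) = l.
  by apply: hcomp_uniq; split=> // t; have [] := lP t.
have al : orbit_class a = orbit_class (\sum_(t \in setT) l t).
  rewrite -xa fE (fsum_morph (phi := orbit_class)) ?linear0 //.
  - by apply: eq_fsbigr => t _; have [_ ->] := lP t.
  - by move=> y z; rewrite linearD.
have [_ <- _] := lP d; rewrite -lE.
by apply/orbit_classP; rewrite -hcompB; apply/orbit_null_hcomp/orbit_classP.
Qed.

Definition orbit_algebra : grAlgebra K H :=
  @GrAlgebra K H orbit_space orbit_mul orbit_comp orbit_mulA
    orbit_comp_subspace orbit_comp_direct orbit_comp_mul.

Lemma orbit_mul_peirce i j k l a b g :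
  peirce e i j a -> peirce e k l b -> gobj X g k = j ->
  orbit_mul (orbit_class a) (orbit_class b) = orbit_class (a ** gact X g b).
Proof.
move=> [a' _ <-] [b' _ <-] gk; rewrite orbit_mulE /twisted_mul; congr orbit_class.
rewrite (@fsumE _ _ [fset g]%fset) ?big_seq_fset1 // => h.
rewrite !gact_mul !gact_e inE => /gmul_eA_Ae jhk.
by apply/eqP/(@gobj_free _ _ k); rewrite gk -jhk.
Qed.

Lemma orbit_mul_peirce0 i j k l a b :
  peirce e i j a -> peirce e k l b -> (forall g, gobj X g k <> j) ->
  orbit_mul (orbit_class a) (orbit_class b) = 0.
Proof.
move=> [a' _ <-] [b' _ <-] gk; rewrite orbit_mulE /twisted_mul fsbig1 ?linear0 //.
move=> g _; apply: contrapT => /eqP; rewrite !gact_mul !gact_e => /gmul_eA_Ae.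
by move=> jgk; apply: (gk g).
Qed.

Lemma orbit_class_inj i a b :
  eA e i a -> eA e i b -> orbit_class a = orbit_class b -> a = b.
Proof.
move=> [a' _ <-] [b' _ <-] /orbit_classP /(twisted_mul_nullr (e i)) /eqP.
rewrite linearBr subr_eq0 /= => /eqP.
suff twE c : twisted_mul (e i) (e i ** c) = e i ** c by rewrite !twE.
rewrite /twisted_mul (@fsumE _ _ [fset 1%g]%fset).
  by rewrite big_seq_fset1 gact1 gr_mulA (df_idem eD).
move=> g; rewrite gact_mul gact_e gr_mulA inE => nz.
apply/eqP/(@gobj_free _ _ i); rewrite gobj1; apply/eqP; apply: contraNT nz.
by rewrite eq_sym => /(df_orth eD) ->; rewrite gmul0l.
Qed.

End Free.
End OrbitAlgebra.

(* Main.v *)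
From HB Require Import structures.
Require Import Defs.
From mathcomp Require Import all_boot all_algebra finmap.
From mathcomp Require Import boolp classical_sets functions cardinality fsbigop.

Set Implicit Arguments.
Unset Strict Implicit.
Unset Printing Implicit Defensive.

Import GRing.Theory.
Local Open Scope classical_set_scope.
Local Open Scope ring_scope.

(** Let [(-,-)] be a graded Nakayama form. Associativity gives
    [(a, b) = (e_i, a b)] for [a] in [e_i A], so the form amounts to one linear
    functional [f = (e_i, -)] for each [i], and its nondegeneracy says that
    [(a, b) |-> f (a b)] pairs perfectly each [e_i A_h e_j] with the component
    [e_j A_(d - h) e_(nu i)], for a fixed degree [d]: the right module [e_i A] is,
    up to a shift, the graded dual of [A e_(nu i)]. This relation between two
    idempotents is [dual_pair]. In a weakly basic algebra each of the two members of a dual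
    pair determines the other ([dual_pair_right_uniq], [dual_pair_left_uniq]),
    because distinct [e_i A] are not isomorphic even up to a shift. Hence a form
    exists as soon as every [e_i] is the left member of a dual pair and every
    [e_k] is the right member of one ([frobenius_family]): the bijection [nu] is
    then automatic, and the functionals glue to a form. Moreover two weakly
    basic families consist, by locality, of the same idempotents up to
    equivalence, and [dual_pair] is invariant under equivalence. So being graded
    pseudo-Frobenius can be tested on any one weakly basic family
    ([graded_pseudo_FrobeniusP]).

    To use this on the orbit algebra [Lam], one shows that its idempotents
    [e_[i]] are a weakly basic family ([orbit_weakly_basic]). The delicate point
    is that [e_[i] Lam_0 e_[i]], the direct sum of the [e_i A_0 e_(g i)], is local
    ([diag_rad_inverse]). A version of Nakayama's lemma in [A_0]
    ([radical0_fixed]) shows that right multiplication by an element whose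
    component in [e_i A_0 e_i] is invertible is injective, and local boundedness
    makes this space finite dimensional, so that the multiplication is onto.

    It remains to compare dual pairs in [A] and in the orbit algebra. Upwards, a
    perfect functional on [e_i A e_k], extended by zero to the other summands
    [e_i A e_(g k)] of [e_[i] Lam e_[k]], is perfect ([dual_pair_orbit]).
    Downwards, the restrictions of a perfect functional to the summands need not
    be perfect. Instead, the functional is traded for an element [w] playing the
    role of a generator of the socle: every non-zero homogeneous element of
    [e_[i] Lam], as well as of [Lam e_[k]], can be multiplied into [w]
    ([dual_pair_socle]). This property passes to any non-zero component of [w],
    in some [e_i A e_(g k)], and a functional not vanishing on that component is
    then perfect ([socle_pair_orbit]). *)

(** * Linear algebra *)

Lemma sum_fset_single (V : zmodType) (T : choiceType) (Y : {fset T}) r (F : T -> V) :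
  (forall t, t != r -> F t = 0) -> (r \notin Y -> F r = 0) ->
  \sum_(t <- Y) F t = F r.
Proof.
move=> F0 Fr; have [rY|rY] := boolP (r \in Y).
  rewrite (big_fsetD1 r) //= big_seq big1 ?addr0 // => t.
  by rewrite !inE => /andP[tr _]; apply: F0.
rewrite Fr // big_seq big1 // => t tY; apply: F0.
by apply: contraNneq rY => <-.
Qed.

Section LinearAlgebra.
Context (K : fieldType).

Definition linear_on (E : lmodType K) (U : set E) (f : E -> K) : Prop :=
  forall (c : K) u v, U u -> U v -> f (c *: u + v) = c * f u + f v.

Lemma subspaceD (E : lmodType K) (U : set E) u v :
  subspace U -> U u -> U v -> U (u + v).
Proof. by move=> [_ UL] Uu Uv; rewrite -[u]scale1r; apply: UL. Qed.

Lemma subspaceZ (E : lmodType K) (U : set E) (c : K) u :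
  subspace U -> U u -> U (c *: u).
Proof. by move=> [U0 UL] Uu; rewrite -[_ *: _]addr0; apply: UL. Qed.

Lemma subspaceN (E : lmodType K) (U : set E) u : subspace U -> U u -> U (- u).
Proof. by rewrite -scaleN1r; apply: subspaceZ. Qed.

Lemma subspaceB (E : lmodType K) (U : set E) u v :
  subspace U -> U u -> U v -> U (u - v).
Proof. by move=> Us Uu Uv; apply: subspaceD => //; apply: subspaceN. Qed.

Lemma subspace_sum (E : lmodType K) (U : set E) (T : eqType) (s : seq T) (F : T -> E) :
  subspace U -> (forall t, t \in s -> U (F t)) -> U (\sum_(t <- s) F t).
Proof.
move=> Us UF; rewrite big_seq; elim/big_ind: _ => //; first by case: Us.
by move=> x y; apply: subspaceD.
Qed.

Lemma linear_on0 (E : lmodType K) (U : set E) f :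
  subspace U -> linear_on U f -> f 0 = 0.
Proof.
move=> [U0 _] fL; have := fL 1 _ _ U0 U0.
by rewrite scaler0 addr0 mul1r => /esym/eqP; rewrite -subr_eq0 addrK => /eqP.
Qed.

Lemma linear_on_big (E : lmodType K) (U : set E) f (T : eqType) (s : seq T) F :
  subspace U -> linear_on U f -> (forall t, t \in s -> U (F t)) ->
  f (\sum_(t <- s) F t) = \sum_(t <- s) f (F t).
Proof.
move=> Us fL UF; rewrite big_seq [RHS]big_seq.
suff [_ //] : U (\sum_(t <- s | t \in s) F t) /\
  f (\sum_(t <- s | t \in s) F t) = \sum_(t <- s | t \in s) f (F t).
elim/big_ind2: _; first by rewrite (linear_on0 Us fL); case: Us.
  move=> x1 x2 y1 y2 [Ux <-] [Uy <-]; split; first exact: subspaceD.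
  by have := fL 1 _ _ Ux Uy; rewrite scale1r mul1r.
by move=> t /UF.
Qed.

Lemma linear_on_sum (E : lmodType K) (U : set E) f n (c : 'I_n -> K) b :
  subspace U -> linear_on U f -> (forall i, U (b i)) ->
  f (\sum_i c i *: b i) = \sum_i c i * f (b i).
Proof.
move=> Us fL Ub; rewrite (linear_on_big Us fL) => [|i _]; last exact: subspaceZ.
apply: eq_bigr => i _; have := fL (c i) _ _ (Ub i) Us.1.
by rewrite !addr0 (linear_on0 Us fL) addr0.
Qed.

(** Subspaces are predicates here; a matrix of maximal rank with rows in [S]
    turns [S] into a row space, to which the rank theory applies. *)
Lemma row_subspace_rowspace n (S : set 'rV[K]_n) :
  subspace S -> exists M : 'M[K]_n, forall v, S v <-> (v <= M)%MS.
Proof.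
move=> Ss; pose rk r := `[< exists M : 'M[K]_n, (forall v, (v <= M)%MS -> S v) /\ \rank M = r >].
have rk0 : exists r, rk r.
  exists 0%N; apply/asboolP; exists 0; rewrite mxrank0; split=> // v.
  by rewrite submx0 => /eqP ->; case: Ss.
have rkn r : rk r -> (r <= n)%N.
  by move=> /asboolP[M [_ <-]]; apply: rank_leq_col.
have [r /asboolP[M [MS Mr]] rmax] := ex_maxnP rk0 rkn.
exists M => v; split; last exact: MS.
move=> Sv; apply: contraT => vM.
have /rmax : rk (\rank (M + v)%MS).
  apply/asboolP; exists (M + v)%MS; split=> // u /sub_addsmxP[[u1 u2] /= ->].
  apply: subspaceD => //; first by apply: MS; apply: submxMl.
  by rewrite [u2]mx11_scalar mul_scalar_mx; apply: subspaceZ.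
rewrite -Mr leqNgt; case/negP.
apply: rank_ltmx; rewrite ltmxE addsmxSl; apply: contra vM.
by apply: submx_trans; apply: addsmxSr.
Qed.

Lemma row_separation n (S : set 'rV[K]_n) v : subspace S -> ~ S v ->
  exists c : 'I_n -> K,
    (forall s, S s -> \sum_i s 0 i * c i = 0) /\ \sum_i v 0 i * c i <> 0.
Proof.
move=> /row_subspace_rowspace[M SM] /(contra_not (SM v).2)/negP.
rewrite submxE => /rV0Pn[j vj].
exists (fun i => cokermx M i j); split; last first.
  by apply/eqP; move: vj; rewrite mxE.
move=> s /SM; rewrite submxE => /eqP/matrixP/(_ 0 j).
by rewrite !mxE.
Qed.

Lemma fin_dim_basis (E : lmodType K) (U : set E) : fin_dim U ->
  exists (n : nat) (b : 'I_n -> E), [/\ forall i, U (b i),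
    forall u, U u -> exists c : 'rV[K]_n, u = \sum_i c 0 i *: b i
    & forall c : 'rV[K]_n, \sum_i c 0 i *: b i = 0 -> c = 0].
Proof.
move=> [s [sU sG]].
pose gen n := `[< exists b : 'I_n -> E, (forall i, U (b i)) /\
   forall u, U u -> exists c : 'rV[K]_n, u = \sum_i c 0 i *: b i >].
have gens : exists n, gen n.
  exists (size s); apply/asboolP; exists (fun i => s`_i); split.
    by move=> i; apply: sU; apply: mem_nth.
  move=> u /sG[c ->]; exists (\row_i c i).
  by apply: eq_bigr => i _; rewrite mxE.
have [n /asboolP[b [bU bG]] nmin] := ex_minnP gens.
exists n, b; split=> // c c0; apply: contrapT => /eqP/rV0Pn[k ck].
case: n => [|n] in b bU bG c c0 k ck nmin *; first by case: k ck.
have /nmin : gen n; last by rewrite ltnn.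
apply/asboolP; exists (b \o lift k); split=> [i|u /bG[a ->]]; first exact: bU.
move: c0; rewrite (bigD1_ord k) //= => /eqP; rewrite addr_eq0 => /eqP ckb.
exists (\row_j (a 0 (lift k j) - a 0 k * (c 0 k)^-1 * c 0 (lift k j))).
rewrite (bigD1_ord k) //=.
have -> : a 0 k *: b k = a 0 k * (c 0 k)^-1 *: (c 0 k *: b k).
  by rewrite scalerA -mulrA mulVf // mulr1.
rewrite ckb scalerN -scaleNr scaler_sumr -big_split; apply: eq_bigr => j _ /=.
by rewrite mxE scalerA addrC -scalerDl mulNr.
Qed.

Lemma functional_separation (E : lmodType K) (U V : set E) w :
  subspace U -> fin_dim U -> subspace V -> U w -> ~ V w ->
  exists f, [/\ linear_on U f, forall v, U v -> V v -> f v = 0 & f w <> 0].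
Proof.
move=> Us /fin_dim_basis[n [b [bU bG bI]]] Vs Uw nVw.
pose comb (c : 'rV[K]_n) := \sum_i c 0 i *: b i.
have combL k c d : comb (k *: c + d) = k *: comb c + comb d.
  rewrite /comb scaler_sumr -big_split; apply: eq_bigr => i _.
  by rewrite !mxE scalerDl scalerA.
have comb_inj c d : comb c = comb d -> c = d.
  move=> cd; apply/eqP; rewrite -subr_eq0; apply/eqP/bI.
  have := combL (-1) d c; rewrite cd !scaleN1r addNr.
  by rewrite addrC.
have /choice[co coE] : forall u, exists c, U u -> u = comb c.
  by move=> u; have [/bG[c ->]|nU] := pselect (U u); [exists c|exists 0].
have [] := @row_separation n [set c | V (comb c)] (co w).
- split=> [|k c d /= Vc Vd]; last by rewrite combL; apply: Vs.2.
  rewrite /= /comb big1; first by case: Vs.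
  by move=> i _; rewrite mxE scale0r.
- by rewrite /= -coE.
move=> f [fV fw]; exists (fun u => \sum_i co u 0 i * f i); split=> //.
- move=> k u v Uu Uv; rewrite mulr_sumr -big_split; apply: eq_bigr => i _ /=.
  suff -> : co (k *: u + v) = k *: co u + co v by rewrite !mxE mulrDl mulrA.
  by apply: comb_inj; rewrite combL -!coE //; apply: Us.2.
- by move=> v Uv Vv; apply: fV; rewrite /= -coE.
Qed.

(** If no non-zero [u] in [U] is annihilated by all of [W], then [W] separates
    the points of the finite dimensional [U], so the functionals [B (-, w)] form
    a subspace of the dual of [U] with zero annihilator: they are everything. *)
Lemma functional_representation (E F : lmodType K) (U : set E) (W : set F)
    (B : E -> F -> K) f :
  subspace U -> fin_dim U -> subspace W ->
  (forall w, W w -> linear_on U (B^~ w)) -> (forall u, U u -> linear_on W (B u)) ->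
  (forall u, U u -> u <> 0 -> exists2 w, W w & B u w <> 0) ->
  linear_on U f -> exists2 w, W w & forall u, U u -> B u w = f u.
Proof.
move=> Us /fin_dim_basis[n [b [bU bG bI]]] Ws Bl Br Bnd fL.
pose S : set 'rV[K]_n := [set c | exists2 w, W w & forall i, c 0 i = B (b i) w].
have [[w Ww wE]|nS] := pselect (S (\row_i f (b i))).
  exists w => // u /bG[c ->].
  rewrite (linear_on_sum _ Us fL bU) (linear_on_sum _ Us (Bl w Ww) bU).
  by apply: eq_bigr => i _; rewrite -wE mxE.
have [|c [cS cf]] := row_separation _ nS.
  split=> [|k c d [v Wv vE] [w Ww wE]].
    exists 0 => [|i]; first by case: Ws.
    by rewrite mxE (linear_on0 Ws (Br _ (bU i))).
  exists (k *: v + w); first exact: Ws.2.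
  by move=> i; rewrite !mxE vE wE Br.
pose u := \sum_i c i *: b i; have Uu : U u.
  by apply: subspace_sum => // i _; apply: subspaceZ.
have u0 : u = 0.
  apply: contrapT => /(Bnd _ Uu)[w Ww]; case.
  rewrite (linear_on_sum _ Us (Bl w Ww) bU).
  rewrite -[RHS](cS (\row_i B (b i) w)); last by exists w => // i; rewrite mxE.
  by apply: eq_bigr => i _; rewrite mxE mulrC.
case: cf; rewrite -[RHS](linear_on0 Us fL) -u0 (linear_on_sum _ Us fL bU).
by apply: eq_bigr => i _; rewrite mxE mulrC.
Qed.

Lemma fin_dim_injective_surjective (E : lmodType K) (U : set E) (f : E -> E) :
  subspace U -> fin_dim U -> (forall u, U u -> U (f u)) ->
  (forall c u v, f (c *: u + v) = c *: f u + f v) ->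
  (forall u, U u -> f u = 0 -> u = 0) ->
  forall v, U v -> exists2 u, U u & f u = v.
Proof.
move=> Us /fin_dim_basis[n [b [bU bG bI]]] fU fL fI.
have f0 : f 0 = 0.
  by have := fL 1 0 0; rewrite !scale1r addr0 => /esym/eqP; rewrite -subr_eq0 addrK => /eqP.
have fcomb (c : 'I_n -> K) x : f (\sum_i c i *: x i) = \sum_i c i *: f (x i).
  have fD u v : f (u + v) = f u + f v by have := fL 1 u v; rewrite !scale1r.
  rewrite (big_morph f fD f0); apply: eq_bigr => i _.
  by have := fL (c i) (x i) 0; rewrite f0 !addr0.
have /choice[m mE] : forall i, exists c : 'rV[K]_n, f (b i) = \sum_j c 0 j *: b j.
  by move=> i; apply: bG; apply: fU.
pose M := \matrix_(i, j) m i 0 j.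
have fM (c : 'rV_n) : f (\sum_i c 0 i *: b i) = \sum_j (c *m M) 0 j *: b j.
  rewrite fcomb; under eq_bigr => i _ do rewrite mE scaler_sumr.
  rewrite exchange_big; apply: eq_bigr => j _.
  by rewrite mxE scaler_suml; apply: eq_bigr => i _; rewrite mxE scalerA.
have Mu : M \in unitmx.
  rewrite -row_free_unit -kermx_eq0; apply/rowV0P => c /sub_kermxP cM.
  apply: bI; apply: fI; first by apply: subspace_sum => // i _; apply: subspaceZ.
  by rewrite fM cM big1 // => j _; rewrite mxE scale0r.
move=> v /bG[c ->]; exists (\sum_i (c *m invmx M) 0 i *: b i).
  by apply: subspace_sum => // i _; apply: subspaceZ.
by rewrite fM mulmxKV.
Qed.

(** A criterion allowing any finite type as index set of the generators. *)
Lemma fin_dim_family (E : lmodType K) (U : set E) (J : finType) (b : J -> E) :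
  (forall j, U (b j)) ->
  (forall u, U u -> exists c : J -> K, u = \sum_j c j *: b j) -> fin_dim U.
Proof.
move=> bU bG; exists [seq b j | j <- enum J]; split=> [_ /mapP[j _ ->] //|u /bG[c ->]].
exists (fun i => nth 0 [seq c j | j <- enum J] i).
rewrite -(big_enum _ _ xpredT (fun j => c j *: b j)) /=.
rewrite size_map; case: (enum J) => [|j0 s]; first by rewrite big_nil big_ord0.
rewrite (big_nth j0) big_mkord; apply: eq_bigr => i _.
by rewrite !(nth_map j0).
Qed.

Lemma fin_dim_image (E F : lmodType K) (U : set E) (f : {linear E -> F}) :
  fin_dim U -> fin_dim (f @` U).
Proof.
move=> /fin_dim_basis[n [b [bU bG _]]].
apply: (@fin_dim_family _ _ _ (f \o b)) => [j|_ [u /bG[c ->] <-]].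
  by exists (b j).
exists (fun j => c 0 j); rewrite linear_sum; apply: eq_bigr => i _.
by rewrite linearZ.
Qed.

Lemma fin_dim_sum (E : lmodType K) (T : eqType) (s : seq T) (U : T -> set E) :
  uniq s -> (forall t, subspace (U t)) -> (forall t, fin_dim (U t)) ->
  fin_dim [set \sum_(t <- s) f t | f in [set f | forall t, U t (f t)]].
Proof.
move=> + Us Ufd; have U0 t : U t 0 by case: (Us t).
elim: s => [_|t s IH /= /andP[ts /IH{IH}]].
  apply: (@fin_dim_family _ _ void (fun=> 0)) => // u [f _ <-].
  by exists (fun=> 0); rewrite big_nil big1 // => -[].
move=> /fin_dim_basis[n [b [bS bG _]]]; have /fin_dim_basis[m [d [dU dG _]]] := Ufd t.
have st r : r \in s -> (r == t) = false.
  by move=> rs; apply: contraNF ts => /eqP <-.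
pose c (j : 'I_m + 'I_n) := match j with inl i => d i | inr i => b i end.
apply: (@fin_dim_family _ _ _ c) => [[i|i]|_ [f fU <-]].
- exists (fun r => if r == t then d i else 0) => [r|].
    by case: eqP => [->|].
  by rewrite big_cons eqxx big_seq big1 ?addr0 // => r /st ->.
- have [f fU fE] := bS i; exists (fun r => if r == t then 0 else f r) => [r|].
    by case: eqP.
  rewrite big_cons eqxx add0r /= -fE big_seq [RHS]big_seq.
  by apply: eq_bigr => r /st ->.
- have [x xE] := dG _ (fU t).
  have [|y yE] := bG (\sum_(r <- s) f r); first by exists f.
  exists (fun j => match j with inl i => x 0 i | inr i => y 0 i end).
  by rewrite big_cons big_sumType /= -xE -yE.
Qed.

End LinearAlgebra.

Lemma fsum_subspace (K : fieldType) (E : lmodType K) (U : set E) (T : choiceType)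
    (F : T -> E) :
  subspace U -> (forall t, U (F t)) -> U (\sum_(t \in setT) F t).
Proof. by move=> Us UF; apply: subspace_sum. Qed.

(** * Homogeneous components *)

Section GradedElements.
Context (K : fieldType) (H : zmodType) (A : grAlgebra K H).
Implicit Types (a b c : A) (h k d : H).

Lemma gmulNl a b : (- a) ** b = - (a ** b).
Proof. by rewrite -scaleN1r gmulZl scaleN1r. Qed.
Lemma gmulNr a b : a ** (- b) = - (a ** b).
Proof. by rewrite -scaleN1r gmulZr scaleN1r. Qed.
Lemma gmulBl a b c : (a - b) ** c = a ** c - b ** c.
Proof. by rewrite gmulDl gmulNl. Qed.
Lemma gmulBr a b c : a ** (b - c) = a ** b - a ** c.
Proof. by rewrite gmulDr gmulNr. Qed.

Lemma decomposition_comp h a : gr_comp A h a ->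
  decomposition (gr_comp A) a (fun k => if k == h then a else 0).
Proof.
move=> ah; split.
- by move=> k; case: (k =P h) => [->//|_]; have [] := @gr_comp_subspace _ _ A k.
- apply: sub_finite_set (finite_set1 h) => k /=.
  by case: (k =P h) => // _; rewrite eqxx.
- rewrite (@fsumE _ _ [fset h]%fset) ?big_seq_fset1 ?eqxx // => k.
  by rewrite inE; case: (k =P h) => // _; rewrite eqxx.
Qed.

Lemma hcomp_id h a : gr_comp A h a -> hcomp a h = a.
Proof. by move=> /decomposition_comp/hcomp_uniq ->; rewrite eqxx. Qed.

Lemma hcomp_neq h k a : gr_comp A h a -> k != h -> hcomp a k = 0.
Proof. by move=> /decomposition_comp/hcomp_uniq -> /negPf ->. Qed.

Lemma hcomp_in a h : gr_comp A h (hcomp a h).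
Proof. by have [] := hcompP a. Qed.

Lemma hcomp_sumE a : exists2 Y : {fset H},
  forall h, h \notin Y -> hcomp a h = 0 & a = \sum_(h <- Y) hcomp a h.
Proof.
have [_ fa aE] := hcompP a; have [Y YP] := finsupp_fset fa; exists Y.
  by move=> h hY; apply/eqP; apply: contraNT hY => /YP.
by rewrite [LHS]aE (fsumE YP).
Qed.

Lemma hcomp_mull k u a h : gr_comp A k u -> hcomp (u ** a) (k + h) = u ** hcomp a h.
Proof.
move=> uk; have [Y aY aE] := hcomp_sumE a.
rewrite {1}aE gmul_sumr hcomp_sum (sum_fset_single (r := h)).
- by rewrite hcomp_id //; apply: gr_comp_mul uk (hcomp_in a h).
- move=> l lh; apply: hcomp_neq (gr_comp_mul uk (hcomp_in a l)) _.
  by rewrite eq_sym; apply: contra_neq lh => /addrI.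
- by move=> /aY ->; rewrite gmul0r hcomp0.
Qed.

Lemma hcomp_mulr k u a h : gr_comp A k u -> hcomp (a ** u) (h + k) = hcomp a h ** u.
Proof.
move=> uk; have [Y aY aE] := hcomp_sumE a.
rewrite {1}aE gmul_suml hcomp_sum (sum_fset_single (r := h)).
- by rewrite hcomp_id //; apply: gr_comp_mul (hcomp_in a h) uk.
- move=> l lh; apply: hcomp_neq (gr_comp_mul (hcomp_in a l) uk) _.
  by rewrite eq_sym; apply: contra_neq lh => /addIr.
- by move=> /aY ->; rewrite gmul0l hcomp0.
Qed.

Lemma hcomp_mul0l u a h : gr_comp A 0 u -> hcomp (u ** a) h = u ** hcomp a h.
Proof. by move=> u0; rewrite -{1}[h]add0r hcomp_mull. Qed.

Lemma hcomp_mul0r u a h : gr_comp A 0 u -> hcomp (a ** u) h = hcomp a h ** u.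
Proof. by move=> u0; rewrite -{1}[h]addr0 hcomp_mulr. Qed.

Lemma gr_comp_mul0l u a h : gr_comp A 0 u -> gr_comp A h a -> gr_comp A h (u ** a).
Proof. by move=> u0 ah; rewrite -[h]add0r; apply: gr_comp_mul. Qed.

Lemma gr_comp_mul0r u a h : gr_comp A 0 u -> gr_comp A h a -> gr_comp A h (a ** u).
Proof. by move=> u0 ah; rewrite -[h]addr0; apply: gr_comp_mul. Qed.

Lemma graded_left_ideal_hcomp (M : set A) a h :
  graded_left_ideal M -> M a -> M (hcomp a h).
Proof. by move=> [_ Mh] /Mh; apply; apply: hcompP. Qed.

End GradedElements.

(** * Local rings *)

(** Here [R] is a subalgebra with a unit [u] of its own. Since locality is stated
    as uniqueness of the maximal left ideal, Zorn's lemma is needed to conclude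
    that every proper left ideal lies in it. *)
Section LocalRing.
Context (K : fieldType) (H : zmodType) (A : grAlgebra K H).
Context (R : set A) (u : A).
Hypotheses (R_subspace : subspace R) (R_mul : forall x y, R x -> R y -> R (x ** y)).
Hypotheses (Ru : R u) (ul : forall x, R x -> u ** x = x) (ur : forall x, R x -> x ** u = x).

Lemma left_ideal_unit (L : set A) : left_ideal R L -> L u -> L = R.
Proof.
move=> [_ LR Lm] Lu; apply/seteqP; split=> // x Rx.
by rewrite -[x]ur //; apply: Lm.
Qed.

Lemma proper_left_ideal_maximal (L : set A) : left_ideal R L -> ~ L u ->
  exists M, maximal_left_ideal R M /\ L `<=` M.
Proof.
move=> LI Lu.
pose P X := left_ideal R (X `|` L) /\ ~ (X `|` L) u.
have [F FP Ftot|N [[NI Nu] Nmax]] := @Zorn_bigcup _ P.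
  have [[L0 LL] LR Lm] := LI.
  have [[X0 FX0]|F0] := pselect (exists X, F X); last first.
    suff -> : \bigcup_(X in F) X = set0 by split; rewrite set0U.
    by apply/seteqP; split=> // x [X FX]; case: F0; exists X.
  have UE : \bigcup_(X in F) X `|` L = \bigcup_(X in F) (X `|` L).
    apply/seteqP; split=> x.
      by case=> [[X FX Xx]|Lx]; [exists X => //; left|exists X0 => //; right].
    by case=> X FX [Xx|Lx]; [left; exists X|right].
  rewrite /P UE; split.
    split.
    - split=> [|c x y [X FX Xx] [Y FY Yy]]; first by exists X0 => //; right.
      have [XY|YX] := Ftot _ _ FX FY.
        exists Y => //; have [[[_ YL] _ _] _] := FP _ FY; apply: YL => //.
        by case: Xx => [/XY|]; [left|right].
      exists X => //; have [[[_ XL] _ _] _] := FP _ FX; apply: XL => //.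
      by case: Yy => [/YX|]; [left|right].
    - by move=> x [X FX Xx]; have [[_ XR _] _] := FP _ FX; apply: XR.
    - move=> r x Rr [X FX Xx]; exists X => //.
      by have [[_ _ Xm] _] := FP _ FX; apply: Xm.
  by move=> [X FX Xu]; have [_] := FP _ FX; apply.
exists (N `|` L); split; last by move=> x; right.
split=> // [NR|N' N'I N'R NN']; first by apply: Nu; rewrite NR.
have N'u : ~ N' u by move=> /(left_ideal_unit N'I).
have LN' : L `<=` N' by move=> x Lx; apply: NN'; right.
have N'L : N' `|` L = N' by apply/setUidPl.
apply/seteqP; split=> // x N'x; left; apply: contrapT => nNx.
apply: (Nmax N'); last by rewrite /P N'L.
split; first by move=> y Ny; apply: NN'; left.
by move=> /(_ x N'x).
Qed.

Definition local_radical : set A := xget set0 (maximal_left_ideal R).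

(** The converse direction, used to produce local rings: a proper left ideal
    outside which every element is left invertible is the only maximal one. *)
Lemma is_local_of_left_inverse (N : set A) : left_ideal R N -> ~ N u ->
  (forall x, R x -> ~ N x -> exists2 y, R y & y ** x = u) -> is_local R.
Proof.
move=> NI Nu Ninv; exists N; split.
  split=> // [NR|L LI LR NL]; first by rewrite NR in Nu.
  apply/seteqP; split=> // x Lx; apply: contrapT => /Ninv[].
    by case: LI => _ LR' _; apply: LR'.
  move=> y Ry yx; apply: LR; apply: (left_ideal_unit LI); rewrite -yx.
  by case: LI => _ _; apply.
move=> L [LI LR Lmax]; apply: Lmax => //; first by move=> NR; rewrite NR in Nu.
move=> x Lx; apply: contrapT => /Ninv[].
  by case: LI => _ LR' _; apply: LR'.
move=> y Ry yx; apply: LR; apply: (left_ideal_unit LI); rewrite -yx.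
by case: LI => _ _; apply.
Qed.

Hypothesis R_local : is_local R.
Local Notation M := local_radical.

Lemma local_radicalP : maximal_left_ideal R M.
Proof. by have [N [NP _]] := R_local; apply: (xgetPex set0 (P := maximal_left_ideal R)); exists N. Qed.

Lemma local_radical_left_ideal : left_ideal R M.
Proof. by have [] := local_radicalP. Qed.

Lemma local_radical_unit : ~ M u.
Proof.
by have [MI MR _] := local_radicalP => Mu; apply: MR; apply: left_ideal_unit.
Qed.

Lemma local_radical_max (L : set A) : left_ideal R L -> ~ L u -> L `<=` M.
Proof.
move=> LI Lu; have [N [NP LN]] := proper_left_ideal_maximal LI Lu.
have [N0 [_ uN0]] := R_local.
by rewrite -(uN0 _ local_radicalP) (uN0 _ NP).
Qed.

Lemma local_left_inverse x : R x -> ~ M x -> exists2 y, R y & y ** x = u.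
Proof.
move=> Rx Mx; have [R0 RL] := R_subspace.
pose L := [set y ** x | y in R].
have LI : left_ideal R L.
  split.
  - split=> [|c _ _ [y Ry <-] [z Rz <-]]; first by exists 0 => //; rewrite gmul0l.
    by exists (c *: y + z); [apply: RL|rewrite gmulDl gmulZl].
  - by move=> _ [y Ry <-]; apply: R_mul.
  - by move=> r _ Rr [y Ry <-]; exists (r ** y); [apply: R_mul|rewrite gr_mulA].
have [[y Ry yx]|/(local_radical_max LI) LM] := pselect (L u); first by exists y.
by case: Mx; apply: LM; exists u => //; apply: ul.
Qed.

(** If the left inverse [y] of [x] were in the radical, then [u - x y] would not,
    so it would be left invertible; as [(u - x y) x = 0], this would give
    [x = 0]. So [y] has a left inverse as well, and it must be [x]. *)
Lemma local_inverse x : R x -> ~ M x ->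
  exists y, [/\ R y, y ** x = u & x ** y = u].
Proof.
move=> Rx Mx; have [MI _ _] := local_radicalP; have [Ms MR Mm] := MI.
have [y Ry yx] := local_left_inverse Rx Mx; exists y; split=> //.
have My : ~ M y.
  move=> /(Mm x _ Rx) Mxy.
  have [||z Rz zxy] := @local_left_inverse (u - x ** y).
  - by apply: subspaceB => //; apply: R_mul.
  - by move=> Mu; apply: local_radical_unit; rewrite -[u](subrK (x ** y)); apply: subspaceD.
  have : (u - x ** y) ** x = 0 by rewrite gmulBl ul // -gr_mulA yx ur // subrr.
  move=> /(congr1 (gr_mul A z)); rewrite gr_mulA zxy ul // gmul0r => x0.
  by apply: Mx; rewrite x0; case: Ms.
have [z Rz zy] := local_left_inverse Ry My.
suff <- : z = x by [].
by rewrite -[z]ur // -yx gr_mulA zy ul.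
Qed.

(** The maximal left ideal is two-sided: if [x r] were invertible, then [x] would
    have a right inverse [s]; as [s x] is in the radical, [u - s x] would be
    invertible, and [(u - s x) s = 0] would give [s = 0]. *)
Lemma local_radicalMr x r : M x -> R r -> M (x ** r).
Proof.
move=> Mx Rr; have [MI _ _] := local_radicalP; have [Ms MR Mm] := MI.
have Rx := MR _ Mx.
apply: contrapT => Mxr.
have [y [Ry _ xry]] := local_inverse (R_mul Rx Rr) Mxr.
have Rs := R_mul Rr Ry; rewrite -gr_mulA in xry.
set s := r ** y in Rs xry.
have [||z [Rz zE _]] := @local_inverse (u - s ** x).
- by apply: subspaceB => //; apply: R_mul.
- move=> Mu; apply: local_radical_unit; rewrite -[u](subrK (s ** x)).
  by apply: subspaceD => //; apply: Mm.
have : (u - s ** x) ** s = 0 by rewrite gmulBl ul // -gr_mulA xry ur // subrr.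
move=> /(congr1 (gr_mul A z)); rewrite gr_mulA zE ul // gmul0r => s0.
by apply: local_radical_unit; rewrite -xry s0 gmul0r; case: Ms.
Qed.

Lemma local_idempotent p : R p -> p ** p = p -> p = 0 \/ p = u.
Proof.
move=> Rp pp; have [MI _ _] := local_radicalP; have [Ms _ _] := MI.
have [Mp|Mp] := pselect (M p); [left|right].
  have Muq : ~ M (u - p).
    by move=> Mq; apply: local_radical_unit; rewrite -[u](subrK p); apply: subspaceD.
  have [y [Ry yq _]] := local_inverse (subspaceB R_subspace Ru Rp) Muq.
  have : (u - p) ** p = 0 by rewrite gmulBl ul // pp subrr.
  by move=> /(congr1 (gr_mul A y)); rewrite gr_mulA yq ul // gmul0r.
have [y [Ry yp _]] := local_inverse Rp Mp.
by rewrite -yp -[in RHS]pp gr_mulA yp ul.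
Qed.

End LocalRing.

(** * Peirce components and the graded radical *)

Section Peirce.
Context (K : fieldType) (H : zmodType) (A : grAlgebra K H).
Context (I : choiceType) (e : I -> A) (eD : distinguished_family e).
Implicit Types (a b c : A) (h k d : H).

Lemma peirce_compP i h j a :
  peirce_comp e i h j a <-> [/\ gr_comp A h a, e i ** a = a & a ** e j = a].
Proof.
split=> [[b bh <-]|[ah ea ae]]; last by exists a; rewrite // ea ae.
split.
- by apply: gr_comp_mul0r; [|apply: gr_comp_mul0l => //]; apply: (df_deg0 eD).
- by rewrite !gr_mulA (df_idem eD).
- by rewrite -!gr_mulA (df_idem eD).
Qed.

Lemma peirceP i j a : peirce e i j a <-> e i ** a = a /\ a ** e j = a.
Proof.
split=> [[b _ <-]|[ea ae]]; last by exists a; rewrite // ea ae.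
by rewrite !gr_mulA (df_idem eD) -!gr_mulA (df_idem eD).
Qed.

Lemma peirce_subspace i j : subspace (peirce e i j).
Proof.
split; first by apply/peirceP; rewrite gmul0l gmul0r.
move=> c u v /peirceP[eu ue] /peirceP[ev ve]; apply/peirceP.
by rewrite gmulDr gmulDl gmulZl gmulZr eu ue ev ve.
Qed.

Lemma peirce_compE i h j : peirce_comp e i h j = peirce e i j `&` gr_comp A h.
Proof.
apply/seteqP; split=> a.
  by move=> /peirce_compP[]; split=> //; apply/peirceP.
by move=> [/peirceP[ea ae] ah]; apply/peirce_compP.
Qed.

Lemma peirce_comp_subspace i h j : subspace (peirce_comp e i h j).
Proof.
have [p0 pL] := peirce_subspace i j; have [h0 hL] := @gr_comp_subspace _ _ A h.
rewrite peirce_compE; split=> // c u v [pu hu] [pv hv].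
by split; [apply: pL|apply: hL].
Qed.

Lemma peirce_hcomp i j a h : peirce e i j a -> peirce e i j (hcomp a h).
Proof.
move=> /peirceP[ea ae]; apply/peirceP.
by rewrite -hcomp_mul0l ?ea -?hcomp_mul0r ?ae //; apply: (df_deg0 eD).
Qed.

Lemma peirce_comp_mul i h j k l a b : peirce_comp e i h j a ->
  peirce_comp e j k l b -> peirce_comp e i (h + k) l (a ** b).
Proof.
move=> /peirce_compP[ah ea _] /peirce_compP[bk _ be]; apply/peirce_compP.
by split; [apply: gr_comp_mul|rewrite gr_mulA ea|rewrite -gr_mulA be].
Qed.

Lemma peirce_comp_idem i : peirce_comp e i 0 i (e i).
Proof. by apply/peirce_compP; rewrite (df_idem eD); split=> //; apply: (df_deg0 eD). Qed.

Lemma row_sumE a : exists2 Y : {fset I},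
  forall i, i \notin Y -> e i ** a = 0 & a = \sum_(i <- Y) e i ** a.
Proof.
have [Y [f aE]] := row_sum eD a; exists Y => [i iY|].
  rewrite aE gmul_sumr big_seq big1 // => j jY.
  by rewrite gr_mulA (df_orth eD) ?gmul0l //; apply: contraNneq iY => ->.
rewrite {1}aE big_seq [RHS]big_seq; apply: eq_bigr => i iY.
rewrite aE gmul_sumr (sum_fset_single (r := i)) => [|j ji|/negP[] //].
  by rewrite gr_mulA (df_idem eD).
by rewrite gr_mulA (df_orth eD) ?gmul0l // eq_sym.
Qed.

Lemma col_sumE a : exists2 Y : {fset I},
  forall i, i \notin Y -> a ** e i = 0 & a = \sum_(i <- Y) a ** e i.
Proof.
have [Y [f aE]] := col_sum eD a; exists Y => [i iY|].
  rewrite aE gmul_suml big_seq big1 // => j jY.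
  by rewrite -gr_mulA (df_orth eD) ?gmul0r //; apply: contraNneq iY => <-.
rewrite {1}aE big_seq [RHS]big_seq; apply: eq_bigr => i iY.
rewrite aE gmul_suml (sum_fset_single (r := i)) => [|j ji|/negP[] //].
  by rewrite -gr_mulA (df_idem eD).
by rewrite -gr_mulA (df_orth eD) ?gmul0r.
Qed.

Lemma row_neq0 a : a <> 0 -> exists i, e i ** a <> 0.
Proof.
move=> a0; apply: contrapT => none; apply: a0.
have [Y _ ->] := row_sumE a; rewrite big1 // => i _.
by apply: contrapT => ea; apply: none; exists i.
Qed.

Lemma col_neq0 a : a <> 0 -> exists i, a ** e i <> 0.
Proof.
move=> a0; apply: contrapT => none; apply: a0.
have [Y _ ->] := col_sumE a; rewrite big1 // => i _.
by apply: contrapT => ea; apply: none; exists i.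
Qed.

Lemma graded_jacobson_left_ideal : left_ideal setT (@graded_jacobson K H A).
Proof.
split=> // [|r m _ mJ M MM].
  split=> [M [[[[]]]] //|c x y xJ yJ M MM].
  have [[[[M0 ML] _ _] _] _ _] := MM.
  by apply: ML; [apply: xJ|apply: yJ].
have [[[_ _ Mm] _] _ _] := MM.
by apply: Mm => //; apply: mJ.
Qed.

Definition corner i : set A := peirce_comp e i 0 i.

Definition corner_rad i : set A := local_radical (corner i).

Lemma cornerM i x y : corner i x -> corner i y -> corner i (x ** y).
Proof. by move=> xR yR; have := peirce_comp_mul xR yR; rewrite addr0. Qed.

Lemma corner_ul i x : corner i x -> e i ** x = x.
Proof. by move=> /peirce_compP[]. Qed.

Lemma corner_ur i x : corner i x -> x ** e i = x.
Proof. by move=> /peirce_compP[]. Qed.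

Section Local.
Hypothesis e_local : forall i, is_local (corner i).

Lemma rad_left_ideal i : left_ideal (corner i) (corner_rad i).
Proof. exact: local_radical_left_ideal (e_local i). Qed.

Lemma rad_subspace i : subspace (corner_rad i).
Proof. by have [] := rad_left_ideal i. Qed.

Lemma rad_corner i x : corner_rad i x -> corner i x.
Proof. by have [_ RC _] := rad_left_ideal i; apply: RC. Qed.

Lemma rad_idem i : ~ corner_rad i (e i).
Proof. by apply: local_radical_unit (e_local i); apply: corner_ur. Qed.

Lemma radMl i x y : corner i x -> corner_rad i y -> corner_rad i (x ** y).
Proof. by have [_ _] := rad_left_ideal i; apply. Qed.

Lemma radMr i x y : corner_rad i x -> corner i y -> corner_rad i (x ** y).
Proof.
exact: (local_radicalMr (peirce_comp_subspace i 0 i) (@cornerM i)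
  (peirce_comp_idem i) (@corner_ul i) (@corner_ur i) (e_local i)).
Qed.

Lemma corner_inverse i x : corner i x -> ~ corner_rad i x ->
  exists y, [/\ corner i y, y ** x = e i & x ** y = e i].
Proof.
exact: (local_inverse (peirce_comp_subspace i 0 i) (@cornerM i)
  (peirce_comp_idem i) (@corner_ul i) (@corner_ur i) (e_local i)).
Qed.

Lemma corner_idempotent i p : corner i p -> p ** p = p -> p = 0 \/ p = e i.
Proof.
exact: (local_idempotent (peirce_comp_subspace i 0 i) (@cornerM i)
  (peirce_comp_idem i) (@corner_ul i) (@corner_ur i) (e_local i)).
Qed.

Lemma rad_complement i x : corner i x -> corner_rad i (e i - x) -> ~ corner_rad i x.
Proof.
move=> xR rx rex; apply: (@rad_idem i); rewrite -[e i](subrK x).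
by apply: subspaceD => //; apply: rad_subspace.
Qed.

(** The maximal graded left ideal whose quotient is the top of [A e_j]; it
    contains [A (1 - e_j)], where [1] is to be read formally. *)
Definition top_ideal j : set A :=
  [set a | forall h b, gr_comp A (- h) b -> corner_rad j (e j ** b ** hcomp a h ** e j)].

Lemma top_corner j h b a : gr_comp A (- h) b -> gr_comp A h a ->
  corner j (e j ** b ** a ** e j).
Proof.
move=> bh ah; apply/peirce_compP.
have e0 := df_deg0 eD j; split.
- apply: gr_comp_mul0r => //; rewrite -[0](addNr h).
  by apply: gr_comp_mul => //; apply: gr_comp_mul0l.
- by rewrite !gr_mulA (df_idem eD).
- by rewrite -!gr_mulA (df_idem eD).
Qed.

Lemma top_ideal_subspace j : subspace (top_ideal j).
Proof.
have rs := rad_subspace j; split=> [h b _|c x y xT yT h b bh].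
  by rewrite hcomp0 gmul0r gmul0l; case: rs.
rewrite hcomp_lin gmulDr gmulZr gmulDl gmulZl.
by apply: rs.2; [apply: xT|apply: yT].
Qed.

Lemma top_ideal_graded j : graded_left_ideal (top_ideal j).
Proof.
have rs := rad_subspace j; split.
  split=> // [|r a _ aT h b bh]; first exact: top_ideal_subspace.
  have [Y _ rE] := hcomp_sumE r.
  rewrite rE gmul_suml hcomp_sum gmul_sumr gmul_suml.
  apply: subspace_sum => // k _.
  have -> : hcomp (hcomp r k ** a) h = hcomp r k ** hcomp a (h - k).
    by rewrite -(hcomp_mull _ _ (hcomp_in r k)) addrC subrK.
  rewrite gr_mulA -(gr_mulA (e j)).
  apply: aT; rewrite opprB addrC; apply: gr_comp_mul => //; exact: hcomp_in.
move=> a f aT /hcomp_uniq <- k h b bh.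
have [hk|hk] := eqVneq h k.
  by rewrite hk hcomp_id ?hk; [apply: aT; rewrite -hk|apply: hcomp_in].
by rewrite (hcomp_neq (hcomp_in a k) hk) gmul0r gmul0l; case: rs.
Qed.

(** A graded ideal [N] that is larger than [top_ideal j] contains some [a] with
    [e_j b a e_j] invertible. As [a - a e_j] lies in [top_ideal j], the ideal [N]
    contains [e_j], hence everything. *)
Lemma top_ideal_maximal j : maximal_graded_left_ideal (top_ideal j).
Proof.
have rs := rad_subspace j; have eM := top_ideal_graded j; split=> //.
  move=> MT; have : top_ideal j (e j) by rewrite MT.
  move=> /(_ 0 (e j)); rewrite oppr0 => /(_ (df_deg0 eD j)).
  by rewrite hcomp_id ?(df_idem eD); [apply: rad_idem|apply: (df_deg0 eD)].
move=> N NG NT MN; apply/seteqP; split=> // a Na h b bh.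
apply: contrapT => nrad; apply: NT; apply/seteqP; split=> // x _.
have [[Ns _ Nm] _] := NG.
(* what e_j annihilates on the right already lies in [top_ideal j] *)
have ann y : y ** e j = 0 -> N y.
  move=> ye; apply: MN => k c _.
  rewrite -gr_mulA -(hcomp_mul0r _ _ (df_deg0 eD j)) ye hcomp0 gmul0r.
  by case: rs.
have Nea : N (hcomp a h ** e j).
  rewrite -[_ ** e j](subKr (hcomp a h)).
  apply: subspaceB => //; first exact: graded_left_ideal_hcomp.
  by apply: ann; rewrite gmulBl -gr_mulA (df_idem eD) subrr.
have [|y [yR yE _]] := corner_inverse _ nrad; first exact: top_corner bh (hcomp_in a h).
have Ne : N (e j) by rewrite -yE -!gr_mulA; do 3!apply: (Nm) => //.
rewrite -[x](subrK (x ** e j)); apply: subspaceD => //; last exact: Nm.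
by apply: ann; rewrite gmulBl -gr_mulA (df_idem eD) subrr.
Qed.

Lemma graded_jacobson_rad j x : corner j x -> graded_jacobson x -> corner_rad j x.
Proof.
move=> xR /(_ _ (top_ideal_maximal j))/(_ 0 (e j)).
rewrite oppr0 => /(_ (df_deg0 eD j)).
have [x0 ex xe] : [/\ gr_comp A 0 x, e j ** x = x & x ** e j = x] by apply/peirce_compP.
by rewrite hcomp_id // (df_idem eD) ex xe.
Qed.

(** Together with its converse [rad_peirce_jacobson], this turns the radical
    condition of weakly basic families into a statement about products of two
    homogeneous elements. *)
Lemma peirce_jacobson_rad i j h a b : peirce e i j `<=` @graded_jacobson K H A ->
  peirce_comp e i h j a -> peirce_comp e j (- h) i b -> corner_rad j (b ** a).
Proof.
move=> ijJ aP bP; apply: graded_jacobson_rad.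
  by have := peirce_comp_mul bP aP; rewrite addNr.
have [_ _ Jm] := graded_jacobson_left_ideal; apply: Jm => //; apply: ijJ.
by move: aP; rewrite peirce_compE => -[].
Qed.

(** If a homogeneous [x] in [e_i A e_j] is outside a maximal graded left ideal
    [M], then [e_j = m + r x] with [m] in [M]; the component of degree [0] makes
    [e_j - b x] an element of [M] with [b x] in the radical of [e_j A_0 e_j], so
    [e_j], and with it [x], is in [M]. *)
Lemma rad_peirce_jacobson i j :
  (forall h a b, peirce_comp e i h j a -> peirce_comp e j (- h) i b ->
     corner_rad j (b ** a)) ->
  peirce e i j `<=` @graded_jacobson K H A.
Proof.
move=> radP a aP M MM; have [[[Ms _ Mm] Mh] MT Mmax] := MM.
have [Y _ ->] := hcomp_sumE a; apply: subspace_sum => // h _.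
have /peirce_compP[ah ea ae] : peirce_comp e i h j (hcomp a h).
  by rewrite peirce_compE; split; [apply: peirce_hcomp|apply: hcomp_in].
set x := hcomp a h in ah ea ae *; apply: contrapT => Mx.
pose N : set A := [set y | exists m r, M m /\ y = m + r ** x].
have NG : graded_left_ideal N.
  split.
    split=> //.
    - split; first by exists 0, 0; rewrite gmul0l addr0; case: Ms.
      move=> c _ _ [m [r [Mm' ->]]] [n [s [Mn ->]]].
      exists (c *: m + n), (c *: r + s); split; first exact: Ms.2.
      by rewrite gmulDl gmulZl scalerDr addrACA.
    - move=> s _ _ [m [r [Mm' ->]]]; exists (s ** m), (s ** r); split; first exact: Mm.
      by rewrite gmulDr gr_mulA.
  move=> _ f [m [r [Mm' ->]]] /hcomp_uniq <- k.
  exists (hcomp m k), (hcomp r (k - h)); split; first exact: graded_left_ideal_hcomp.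
  by rewrite hcompD -(hcomp_mulr _ _ ah) subrK.
have MN : M `<=` N by move=> m Mm'; exists m, 0; rewrite gmul0l addr0.
have Nx : N x by exists 0, (e i); rewrite add0r ea; split=> //; case: Ms.
have NT : N = setT.
  by apply: contrapT => NT; apply: Mx; rewrite -(Mmax N).
have : N (e j) by rewrite NT.
move=> [m [r [Mm' ejE]]].
pose b := e j ** hcomp r (- h) ** e i.
have bP : peirce_comp e j (- h) i b by exists (hcomp r (- h)) => //; apply: hcomp_in.
have xP : peirce_comp e i h j x by apply/peirce_compP.
have bx := radP _ _ _ xP bP.
have ebx : M (e j - b ** x).
  have ej0 : e j = hcomp m 0 + hcomp r (- h) ** x.
    rewrite -[LHS](hcomp_id (df_deg0 eD j)) ejE hcompD.
    by rewrite -[in X in _ + X](addNr h) (hcomp_mulr _ _ ah).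
  have -> : e j - b ** x = e j ** hcomp m 0.
    have /(congr1 (gr_mul A (e j))) := ej0.
    by rewrite (df_idem eD) gmulDr => {1}->; rewrite /b -!gr_mulA ea addrK.
  by apply: Mm => //; apply: graded_left_ideal_hcomp => //; case: MM.
have [] := @corner_inverse j (e j - b ** x).
- apply: subspaceB; [exact: peirce_comp_subspace|exact: peirce_comp_idem|].
  exact: rad_corner.
- apply: rad_complement; last by rewrite subKr.
  apply: subspaceB; [exact: peirce_comp_subspace|exact: peirce_comp_idem|].
  exact: rad_corner.
move=> y [_ yE _]; apply: Mx; rewrite -ae -yE.
by do 2!apply: (Mm) => //.
Qed.

End Local.
End Peirce.

(** * Dual pairs of idempotents *)

Section DualPair.
Context (K : fieldType) (H : zmodType) (A : grAlgebra K H).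
Implicit Types (a b c p q : A) (h k d : H).

(** When the Peirce components are finite dimensional, the pairing
    [(a, b) |-> f (a b)] identifies [p A] with the graded dual of [A q] shifted by
    [d], one Peirce component at a time. *)
Definition perfect_functional p q d (f : A -> K) : Prop :=
  [/\ linear_on setT f,
      forall h a, gr_comp A h a -> p ** a = a -> a <> 0 ->
        exists b, [/\ gr_comp A (d - h) b, b ** q = b & f (a ** b) <> 0]
    & forall h b, gr_comp A h b -> b ** q = b -> b <> 0 ->
        exists a, [/\ gr_comp A (d - h) a, p ** a = a & f (a ** b) <> 0]].

Definition dual_pair p q : Prop := exists d f, perfect_functional p q d f.

(** The element [w] generates the smallest non-zero graded submodule of [p A] and
    also that of [A q]. *)
Definition socle_pair p q : Prop := exists d w,
  [/\ [/\ gr_comp A d w, p ** w = w & w ** q = w], w <> 0,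
      forall h a, gr_comp A h a -> p ** a = a -> a <> 0 ->
        exists b, [/\ gr_comp A (d - h) b, b ** q = b & a ** b = w]
    & forall h b, gr_comp A h b -> b ** q = b -> b <> 0 ->
        exists a, [/\ gr_comp A (d - h) a, p ** a = a & a ** b = w]].

Lemma functionalB (f : A -> K) x y : linear_on setT f -> f (x - y) = f x - f y.
Proof.
by move=> fL; rewrite addrC -scaleN1r fL // mulN1r addrC.
Qed.

Lemma subspaceT : subspace (setT : set A). Proof. by []. Qed.

Lemma functional0 (f : A -> K) : linear_on setT f -> f 0 = 0.
Proof. exact: linear_on0 subspaceT. Qed.

Lemma functional_sum (f : A -> K) (T : Type) (s : seq T) (F : T -> A) :
  linear_on setT f -> f (\sum_(t <- s) F t) = \sum_(t <- s) f (F t).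
Proof.
move=> fL; apply: (big_morph f _ (functional0 fL)) => x y.
by have := fL 1 x y I I; rewrite scale1r mul1r.
Qed.

(** Left multiplications by [u] and [v] are mutually inverse isomorphisms between
    the graded right modules [q A] and [p A]. *)
Definition idem_equiv p q : Prop := exists u v,
  [/\ gr_comp A 0 u /\ gr_comp A 0 v, u ** q = u, v ** p = v,
      u ** v = p & v ** u = q].

Lemma idem_equiv_sym p q : idem_equiv p q -> idem_equiv q p.
Proof. by move=> [u [v [[u0 v0] uq vp uv vu]]]; exists v, u. Qed.

Lemma dual_pair_equiv p p' q q' : idem_equiv p p' -> idem_equiv q q' ->
  dual_pair p q -> dual_pair p' q'.
Proof.
move=> [u [v [[u0 v0] up' vp uv vu]]] [s [t [[s0 t0] sq' tq st ts]]].
move=> [d [f [fL fl fr]]].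
have pu : p ** u = u by rewrite -uv -gr_mulA vu up'.
have qs : q ** s = s by rewrite -st -gr_mulA ts sq'.
have p'v : p' ** v = v by rewrite -vu -gr_mulA uv vp.
have q't : q' ** t = t by rewrite -ts -gr_mulA st tq.
exists d, (fun x => f (u ** x ** t)); split.
- by move=> c x y _ _; rewrite gmulDr gmulZr gmulDl gmulZl fL.
- move=> h a ah p'a a0; have [| | |b [bh bq fb]] := fl h (u ** a).
  + exact: gr_comp_mul0l.
  + by rewrite gr_mulA pu.
  + by move=> ua; apply: a0; rewrite -p'a -vu -gr_mulA ua gmul0r.
  exists (b ** s); split; first exact: gr_comp_mul0r.
    by rewrite -gr_mulA sq'.
  by rewrite -!gr_mulA st bq gr_mulA.
- move=> h b bh bq' b0; have [| | |a [ah pa fa]] := fr h (b ** t).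
  + exact: gr_comp_mul0r.
  + by rewrite -gr_mulA tq.
  + by move=> bt; apply: b0; rewrite -bq' -ts gr_mulA bt gmul0l.
  exists (v ** a); split; first exact: gr_comp_mul0l.
    by rewrite gr_mulA p'v.
  by rewrite !gr_mulA uv pa -gr_mulA.
Qed.

End DualPair.

Section WeaklyBasic.
Context (K : fieldType) (H : zmodType) (A : grAlgebra K H).
Context (I : choiceType) (e : I -> A) (e_wb : weakly_basic_family e).
Implicit Types (a b c : A) (h d : H) (i j k : I).

Let eD := wb_distinguished e_wb.
Let e_local : forall i, is_local (corner e i) := wb_local e_wb.

Lemma peirce_comp_fin_dim i h j : fin_dim (peirce_comp e i h j).
Proof. exact: wb_lfd e_wb i h j. Qed.

(** Perfectness represents every functional on a Peirce component by right
    multiplication; [perfect_functional_left] is the mirror image. *)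
Lemma perfect_functional_right i k k' d d' f f' :
  perfect_functional (e i) (e k) d f -> linear_on (peirce_comp e i d' k') f' ->
  exists2 c, peirce_comp e k' (d - d') k c &
    forall x, peirce_comp e i d' k' x -> f (x ** c) = f' x.
Proof.
move=> [fL fl _] f'L.
apply: (functional_representation (B := fun x c => f (x ** c))) f'L.
- exact: peirce_comp_subspace.
- exact: peirce_comp_fin_dim.
- exact: peirce_comp_subspace.
- by move=> w _ c x y _ _; rewrite gmulDl gmulZl fL.
- by move=> u _ c x y _ _; rewrite gmulDr gmulZr fL.
- move=> u /(peirce_compP eD)[ud eu ue] u0.
  have [b [bd be fb]] := fl _ _ ud eu u0.
  exists (e k' ** b); last by rewrite gr_mulA ue.
  apply/(peirce_compP eD); rewrite -!gr_mulA be gr_mulA (df_idem eD).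
  by split=> //; apply: gr_comp_mul0l => //; apply: (df_deg0 eD).
Qed.

Lemma perfect_functional_left i i' k d d' f f' :
  perfect_functional (e i) (e k) d f -> linear_on (peirce_comp e i' d' k) f' ->
  exists2 c, peirce_comp e i (d - d') i' c &
    forall x, peirce_comp e i' d' k x -> f (c ** x) = f' x.
Proof.
move=> [fL _ fr] f'L.
apply: (functional_representation (B := fun x c => f (c ** x))) f'L.
- exact: peirce_comp_subspace.
- exact: peirce_comp_fin_dim.
- exact: peirce_comp_subspace.
- by move=> w _ c x y _ _; rewrite gmulDr gmulZr fL.
- by move=> u _ c x y _ _; rewrite gmulDl gmulZl fL.
- move=> u /(peirce_compP eD)[ud eu ue] u0.
  have [a [ad ea fa]] := fr _ _ ud ue u0.
  exists (a ** e i'); last by rewrite -gr_mulA eu.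
  apply/(peirce_compP eD); rewrite gr_mulA ea -gr_mulA (df_idem eD).
  by split=> //; apply: gr_comp_mul0r => //; apply: (df_deg0 eD).
Qed.

Lemma linear_onW (U : set A) f : linear_on setT f -> linear_on U f.
Proof. by move=> fL c u v _ _; apply: fL. Qed.

(** Distinct idempotents of a weakly basic family are not equivalent, even up to a
    shift of the degree. *)
Lemma offdiagonal_product h i j a b : i != j ->
  peirce_comp e i h j a -> peirce_comp e j (- h) i b -> b ** a <> e j.
Proof.
move=> ij aP bP ba; apply: (rad_idem eD e_local (i := j)); rewrite -ba.
by apply: (peirce_jacobson_rad eD e_local (wb_radical e_wb ij)) aP bP.
Qed.

(** Each of the two functionals is represented by means of the other, by right
    multiplication by [c] and [c'] respectively. Applying both shows that
    [c' c] acts on functionals as [e_k], so [c' c = e_k], which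
    [offdiagonal_product] forbids when [k] and [k'] differ. *)
Lemma dual_pair_right_uniq i k k' :
  dual_pair (e i) (e k) -> dual_pair (e i) (e k') -> k = k'.
Proof.
move=> [d [f fP]] [d' [f' f'P]]; have [fL _ fr] := fP; have [f'L _ _] := f'P.
have [c cP cE] := perfect_functional_right (k' := k') (d' := d') fP (linear_onW f'L).
have [c' c'P c'E] := perfect_functional_right (k' := k) (d' := d) f'P (linear_onW fL).
have := (peirce_compP eD _ _ _ _).1 c'P => -[c'd ec' c'e].
have := (peirce_compP eD _ _ _ _).1 cP => -[cd ec ce].
have [//|kk'] := eqVneq k k'.
case: (@offdiagonal_product (d - d') k' k c c') => //; first by rewrite eq_sym.
  by rewrite opprB.
have ccP : corner e k (c' ** c).
  by have := peirce_comp_mul eD c'P cP; rewrite addrA subrK subrr.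
apply/esym/eqP; rewrite -subr_eq0; apply/eqP; apply: contrapT => nz.
have /(peirce_compP eD)[xd _ xe] : corner e k (e k - c' ** c).
  by apply: subspaceB => //; [apply: peirce_comp_subspace|apply: peirce_comp_idem].
have [a [ad ea]] := fr 0 _ xd xe nz; rewrite subr0 in ad; case.
have aP : peirce_comp e i d k (a ** e k).
  apply/(peirce_compP eD); rewrite gr_mulA ea -gr_mulA (df_idem eD).
  by split=> //; apply: gr_comp_mul0r => //; apply: (df_deg0 eD).
have acP : peirce_comp e i d' k' (a ** c').
  have := peirce_comp_mul eD aP c'P; rewrite addrC subrK.
  by rewrite -gr_mulA ec'.
by rewrite gmulBr functionalB // gr_mulA cE // -ec' gr_mulA c'E // subrr.
Qed.

Lemma dual_pair_left_uniq i i' k :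
  dual_pair (e i) (e k) -> dual_pair (e i') (e k) -> i = i'.
Proof.
move=> [d [f fP]] [d' [f' f'P]]; have [fL fl _] := fP; have [f'L _ _] := f'P.
have [c cP cE] := perfect_functional_left (i' := i') (d' := d') fP (linear_onW f'L).
have [c' c'P c'E] := perfect_functional_left (i' := i) (d' := d) f'P (linear_onW fL).
have := (peirce_compP eD _ _ _ _).1 c'P => -[c'd ec' c'e].
have [//|ii'] := eqVneq i i'.
case: (@offdiagonal_product (d' - d) i' i c' c) => //; first by rewrite eq_sym.
  by rewrite opprB.
have ccP : corner e i (c ** c').
  by have := peirce_comp_mul eD cP c'P; rewrite addrA subrK subrr.
apply/esym/eqP; rewrite -subr_eq0; apply/eqP; apply: contrapT => nz.
have /(peirce_compP eD)[xd ex _] : corner e i (e i - c ** c').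
  by apply: subspaceB => //; [apply: peirce_comp_subspace|apply: peirce_comp_idem].
have [b [bd be]] := fl 0 _ xd ex nz; rewrite subr0 in bd; case.
have bP : peirce_comp e i d k (e i ** b).
  apply/(peirce_compP eD); rewrite -!gr_mulA be gr_mulA (df_idem eD).
  by split=> //; apply: gr_comp_mul0l => //; apply: (df_deg0 eD).
have cbP : peirce_comp e i' d' k (c' ** b).
  have := peirce_comp_mul eD c'P bP; rewrite subrK.
  by rewrite gr_mulA c'e.
by rewrite gmulBl functionalB // -gr_mulA cE // -c'e -gr_mulA c'E // subrr.
Qed.

(** The element [w] represents a functional [chi] on the local algebra
    [e_k A_0 e_k] that kills the radical. If [w] were not a product [a b] with
    the given [a], a functional separating [w] from these products would be right
    multiplication by some [x] with [chi x <> 0]; such an [x] is invertible, so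
    the functional [f] itself would vanish on all [a b]. *)
Lemma dual_pair_socle i k : dual_pair (e i) (e k) -> socle_pair (e i) (e k).
Proof.
move=> [d [f fP]]; have [fL fl fr] := fP.
have Rs := peirce_comp_subspace eD.
(* a functional on the local algebra e_k A_0 e_k detecting its units *)
have [chi [chiL chi_rad chi1]] := functional_separation (Rs k 0 k)
  (peirce_comp_fin_dim k 0 k) (rad_subspace e_local k) (peirce_comp_idem eD k)
  (rad_idem eD e_local (i := k)).
have [w] := perfect_functional_left fP chiL; rewrite subr0 => wP wE.
have /(peirce_compP eD)[wd ew we] := wP.
(* a functional separating w from a subspace V of the products of degree d
   comes from right multiplication by a unit x of e_k A_0 e_k *)
have sep (V : set A) : subspace V -> ~ V w -> exists x x', [/\ corner e k x,
    corner e k x', x ** x' = e k, x' ** x = e k &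
    forall y, peirce_comp e i d k y -> V y -> f (y ** x) = 0].
  move=> Vs Vw; have [psi [psiL psiV psiw]] := functional_separation (Rs i d k)
    (peirce_comp_fin_dim i d k) Vs wP Vw.
  have [x] := perfect_functional_right fP psiL; rewrite subrr => xP xE.
  have xrad : ~ corner_rad e k x.
    by move=> /chi_rad chix; apply: psiw; rewrite -xE // wE // chix.
  have [x' [x'P x'x xx']] := corner_inverse eD e_local xP xrad.
  exists x, x'; split=> // y yP Vy; by rewrite xE // psiV.
exists d, w; split.
- by [].
- by move=> w0; apply: chi1; rewrite -wE ?w0 ?gmul0l ?functional0 //; apply: peirce_comp_idem.
- move=> h a ah ea a0; apply: contrapT => none.
  pose V := [set a ** b | b in [set b | gr_comp A (d - h) b /\ b ** e k = b]].
  have Vs : subspace V.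
    have [h0 hL] := @gr_comp_subspace _ _ A (d - h).
    split; first by exists 0; rewrite /= ?gmul0l ?gmul0r.
    move=> c _ _ [x [xh xe] <-] [y [yh ye] <-]; exists (c *: x + y); last by rewrite gmulDr gmulZr.
    by split; [apply: hL|rewrite gmulDl gmulZl xe ye].
  have [|x [x' [/(peirce_compP eD)[x0 ex xe] /(peirce_compP eD)[x'0 ex' x'e] xx' x'x fV]]] := sep V Vs.
    by move=> [b [bh be] ab]; apply: none; exists b.
  have [b [bh be]] := fl _ _ ah ea a0; case.
  have byP : gr_comp A (d - h) (b ** x') /\ (b ** x') ** e k = b ** x'.
    by rewrite -gr_mulA x'e; split=> //; apply: gr_comp_mul0r.
  have -> : a ** b = (a ** (b ** x')) ** x by rewrite -!gr_mulA x'x be.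
  apply: fV; last by exists (b ** x').
  have [bxd bxe] := byP; apply/(peirce_compP eD); split.
  + by rewrite -[d](subrK h) addrC; apply: gr_comp_mul.
  + by rewrite gr_mulA ea.
  + by rewrite -gr_mulA bxe.
- move=> h b bh be b0; apply: contrapT => none.
  pose V := [set a ** b | a in [set a | gr_comp A (d - h) a /\ e i ** a = a]].
  have Vs : subspace V.
    have [h0 hL] := @gr_comp_subspace _ _ A (d - h).
    split; first by exists 0; rewrite /= ?gmul0l ?gmul0r.
    move=> c _ _ [x [xh xe] <-] [y [yh ye] <-]; exists (c *: x + y); last by rewrite gmulDl gmulZl.
    by split; [apply: hL|rewrite gmulDr gmulZr xe ye].
  have [|x [x' [/(peirce_compP eD)[x0 ex xe] /(peirce_compP eD)[x'0 ex' x'e] xx' x'x fV]]] := sep V Vs.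
    by move=> [a [ah ea] ab]; apply: none; exists a.
  have [| | |a [ah ea]] := fr h (b ** x).
  + exact: gr_comp_mul0r.
  + by rewrite -gr_mulA xe.
  + by move=> bx; apply: b0; rewrite -be -xx' gr_mulA bx gmul0l.
  case; rewrite gr_mulA; apply: fV; last by exists a.
  apply/(peirce_compP eD); split.
  + by rewrite -[d](subrK h); apply: gr_comp_mul.
  + by rewrite gr_mulA ea.
  + by rewrite -gr_mulA be.
Qed.

End WeaklyBasic.

(** * Nakayama forms as families of dual pairs *)

Section GradedDuality.
Context (K : fieldType) (H : zmodType) (A : grAlgebra K H).
Implicit Types (a b v w : A) (h d : H).

(** Nondegeneracy against the graded dual can be checked on homogeneous elements:
    a functional of finite support is represented degree by degree. *)
Lemma homogeneous_pairing_dual (V W : set A) (B : A -> A -> K) d :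
  subspace V -> subspace W ->
  (forall h v, V v -> V (hcomp v h)) -> (forall h w, W w -> W (hcomp w h)) ->
  (forall w, linear_on setT (B^~ w)) -> (forall v, linear_on setT (B v)) ->
  (forall h, fin_dim (V `&` gr_comp A h)) ->
  form_of_degree V W B d ->
  (forall h v, V v -> gr_comp A h v -> v <> 0 ->
     exists w, [/\ W w, gr_comp A (d - h) w & B v w <> 0]) ->
  (forall h w, W w -> gr_comp A h w -> w <> 0 ->
     exists v, [/\ V v, gr_comp A (d - h) v & B v w <> 0]) ->
  bijects_onto_dual W V (fun w v => B v w).
Proof.
move=> Vs Ws Vh Wh Bl Br Vfd Bd BV BW.
have Bneq h k v w : V v -> gr_comp A h v -> W w -> gr_comp A k w ->
    h <> d - k -> B v w = 0.
  move=> Vv vh Ww wk hk; apply/eqP; apply: contraT => Bvw; case: hk.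
  by rewrite -(Bd h k v w) // addrK.
split=> [w Ww|phi [phiL /finsupp_fset[X XP]]].
  split=> [c u v Vu Vv|]; first exact: Bl.
  have [Y _ wE] := hcomp_sumE w.
  apply: sub_finite_set (finite_image (fun k => d - k) (finite_fset Y)) => h /=.
  move=> [v [Vv vh] Bvw]; apply: contrapT => none; move: Bvw.
  rewrite wE functional_sum // big_seq big1 ?eqxx // => k kY.
  apply: (Bneq h k) => //; [exact: Wh|exact: hcomp_in|].
  by move=> hk; apply: none; exists k.
have Vhs h : subspace (V `&` gr_comp A h).
  have [h0 hL] := @gr_comp_subspace _ _ A h; have [V0 VL] := Vs.
  by split=> // c u v [Vu uh] [Vv vh]; split; [apply: VL|apply: hL].
have /choice[om omP] : forall h, exists w, [/\ W w, gr_comp A (d - h) w &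
    forall v, V v -> gr_comp A h v -> B v w = phi v].
  move=> h.
  have [| | | | |w [Ww wh] wE] := @functional_representation K A A
    (V `&` gr_comp A h) (W `&` gr_comp A (d - h)) B phi (Vhs h) (Vfd h).
  - have [h0 hL] := @gr_comp_subspace _ _ A (d - h); have [W0 WL] := Ws.
    by split=> // c u v [Wu uh] [Wv vh]; split; [apply: WL|apply: hL].
  - by move=> w _ c x y _ _; apply: Bl.
  - by move=> u _ c x y _ _; apply: Br.
  - by move=> u [Vu uh] /(BV _ _ Vu uh)[w [Ww wh Buw]]; exists w.
  - by move=> c x y [Vx _] [Vy _]; apply: phiL.
  by exists w; split=> // v Vv vh; apply: wE.
pose w := \sum_(h <- X) om h.
have Ww : W w by apply: subspace_sum => // h _; have [] := omP h.
have wE v : V v -> B v w = phi v.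
  move=> Vv; have [Y _ vE] := hcomp_sumE v.
  rewrite vE (functional_sum _ _ (Bl _)) (linear_on_big Vs phiL); last first.
    by move=> k _; apply: Vh.
  apply: eq_bigr => k _; have vk := hcomp_in v k; have Vk := Vh k v Vv.
  rewrite (functional_sum _ _ (Br _)).
  have offk h : h != k -> B (hcomp v k) (om h) = 0.
    have [Wom omh _] := omP h; move=> hk; apply: (Bneq k (d - h)) => //.
    by rewrite subKr => kh; rewrite kh eqxx in hk.
  have [_ _ omE] := omP k.
  rewrite (sum_fset_single (r := k)) ?omE // => kX.
  by apply/eqP; apply: contraNT kX => phik; apply: XP; exists (hcomp v k).
exists w; split=> // w' [Ww' w'E].
apply/eqP; rewrite -subr_eq0; apply/eqP.
have [Y xY xE] := hcomp_sumE (w - w').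
have Wx : W (w - w') by apply: subspaceB.
rewrite xE big1 // => k _; apply: contrapT => xk.
have [v [Vv vd]] := BW k _ (Wh k _ Wx) (hcomp_in _ _) xk; case.
have <- : B v (w - w') = B v (hcomp (w - w') k); last by rewrite functionalB // wE // w'E // subrr.
rewrite {1}xE functional_sum // (sum_fset_single (r := k)) // => [h hk|/xY ->].
  apply: (Bneq (d - k) h) => //; [exact: Wh|exact: hcomp_in|].
  by move=> /addrI /oppr_inj kh; rewrite kh eqxx in hk.
exact: functional0.
Qed.

End GradedDuality.

Section FormOfFunctional.
Context (K : fieldType) (H : zmodType) (A : grAlgebra K H).
Context (f : A -> K) (f_linear : linear_on setT f).

Definition form_of (a b : A) : K := f (a ** b).

Lemma form_of_bilinear : bilinear_for *%R *%R form_of.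
Proof.
split=> [c k a b|a k b c]; first by rewrite /form_of gmulDl gmulZl f_linear.
by rewrite /form_of gmulDr gmulZr f_linear.
Qed.

HB.instance Definition _ :=
  bilinear_isBilinear.Build K A A K *%R *%R form_of form_of_bilinear.

Lemma exists_form_of : exists B : {biscalar A}, forall a b, B a b = f (a ** b).
Proof. by exists form_of. Qed.

End FormOfFunctional.

Section FrobeniusFamily.
Context (K : fieldType) (H : zmodType) (A : grAlgebra K H).

(** The existence of the Nakayama permutation, without choosing it. *)
Definition frobenius_family (I : choiceType) (e : I -> A) : Prop :=
  (forall i, exists k, dual_pair (e i) (e k)) /\
  (forall k, exists i, dual_pair (e i) (e k)).

Lemma biscalar_linearr (B : {biscalar A}) a : linear_on setT (B a).
Proof. by move=> c x y _ _; rewrite linearPr. Qed.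

Lemma biscalar_linearl (B : {biscalar A}) a : linear_on setT (B^~ a).
Proof. by move=> c x y _ _; rewrite linearPl. Qed.

Lemma bijects_onto_dual_neq0 (V W : set A) (B : A -> A -> K) v :
  bijects_onto_dual V W B -> V 0 -> (forall w, B 0 w = 0) -> V v -> v <> 0 ->
  exists2 w, W w & B v w <> 0.
Proof.
move=> [_ Bdual] V0 B0 Vv v0; apply: contrapT => none; apply: v0.
have [|x [_ xU]] := Bdual (fun=> 0).
  split=> [c u w _ _|]; first by rewrite mulr0 addr0.
  suff -> : [set h | exists2 w, (W `&` gr_comp A h) w & (0 : K) != 0] = set0 by [].
  by apply/seteqP; split=> // h [w _]; rewrite eqxx.
rewrite -(xU v) ?(xU 0) //; split=> // w Ww.
by apply: contrapT => Bvw; apply: none; exists w.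
Qed.

Lemma nakayama_form_frobenius_family (I : choiceType) (e : I -> A) (B : {biscalar A}) :
  distinguished_family e -> graded_nakayama_form e B -> frobenius_family e.
Proof.
move=> eD [BM [nu [nu_bij _ [deg degP]]]].
have Br := biscalar_linearr B; have Bl := biscalar_linearl B.
suff dp i : dual_pair (e i) (e (nu i)).
  split=> [i|k]; first by exists (nu i).
  by have [mu _ muK] := nu_bij; exists (mu k); rewrite -{2}(muK k).
have BE a b : e i ** a = a -> B a b = B (e i) (a ** b).
  by move=> ea; rewrite -BM ea.
exists (deg i), (B (e i)); split=> // [h a ah ea a0|h b bh be b0].
- have [j aj0] := col_neq0 eD a0.
  have [[_ Bdual] Bd] := degP i j.
  have ajP : peirce e i j (a ** e j).
    by apply/(peirceP eD); rewrite gr_mulA ea -gr_mulA (df_idem eD).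
  have [| |w wP Bw] := bijects_onto_dual_neq0 Bdual _ _ ajP aj0.
  + by case: (peirce_subspace eD i j).
  + by move=> w; apply: functional0 (Bl w).
  have [Y _ wE] := hcomp_sumE w.
  have [l Bwl] : exists l, B (a ** e j) (hcomp w l) <> 0.
    apply: contrapT => none; apply: Bw; rewrite wE functional_sum //.
    by rewrite big1 // => l _; apply: contrapT => Bl'; apply: none; exists l.
  have /(peirceP eD)[ew we] := peirce_hcomp eD l wP.
  have hl : h + l = deg i.
    apply: (Bd h l (a ** e j) (hcomp w l)); last exact/eqP.
      by split=> //; apply: gr_comp_mul0r => //; apply: (df_deg0 eD).
    by split; [apply: (peirce_hcomp eD)|apply: hcomp_in].
  exists (hcomp w l); split=> //.
    by rewrite -hl addrC addKr; apply: hcomp_in.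
  by rewrite -BE // -ew -BM.
- have [j jb0] := row_neq0 eD b0.
  have [[Bdual _] Bd] := degP i j.
  have jbP : peirce e j (nu i) (e j ** b).
    by apply/(peirceP eD); rewrite -!gr_mulA be gr_mulA (df_idem eD).
  have [| |v vP Bv] := bijects_onto_dual_neq0 Bdual _ _ jbP jb0.
  + by case: (peirce_subspace eD j (nu i)).
  + by move=> v; apply: functional0 (Br v).
  have [Y _ vE] := hcomp_sumE v.
  have [l Bvl] : exists l, B (hcomp v l) (e j ** b) <> 0.
    apply: contrapT => none; apply: Bv; rewrite vE (functional_sum _ _ (Bl _)).
    by rewrite big1 // => l _; apply: contrapT => Bl'; apply: none; exists l.
  have /(peirceP eD)[ev ve] := peirce_hcomp eD l vP.
  have hl : l + h = deg i.
    apply: (Bd l h (hcomp v l) (e j ** b)); last exact/eqP.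
      by split; [apply: (peirce_hcomp eD)|apply: hcomp_in].
    by split=> //; apply: gr_comp_mul0l => //; apply: (df_deg0 eD).
  exists (hcomp v l); split=> //.
    by rewrite -hl addrK; apply: hcomp_in.
  by rewrite -BE // -ve BM.
Qed.

Lemma finite_row_support (I : choiceType) (e : I -> A) a :
  distinguished_family e -> finite_set [set i | e i ** a != 0].
Proof.
move=> eD; have [Y aY _] := row_sumE eD a.
apply: sub_finite_set (finite_fset Y) => i /=.
by apply: contraNT => /aY ->.
Qed.

(** The functionals [f i], cut down to [e_i A e_(nu i)] in degree [deg i], add up
    to one functional [Phi], and the form is [(a, b) |-> Phi (a b)]. *)
Lemma frobenius_family_nakayama_form (I : choiceType) (e : I -> A) :
  weakly_basic_family e -> frobenius_family e ->
  exists B : {biscalar A}, graded_nakayama_form e B.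
Proof.
move=> e_wb [dp pd]; have eD := wb_distinguished e_wb.
have /choice[nu nuP] := dp.
have nu_bij : bijective nu.
  have /choice[mu muP] := pd.
  exists mu => i; last exact: (dual_pair_right_uniq e_wb (nuP (mu i)) (muP i)).
  exact: (dual_pair_left_uniq e_wb (muP (nu i)) (nuP i)).
have /choice[deg /choice[f fP]] := nuP.
have fL i : linear_on setT (f i) by have [] := fP i.
have e0 := df_deg0 eD.
pose F x i := f i (hcomp (e i ** x) (deg i) ** e (nu i)).
pose Phi x := \sum_(i \in setT) F x i.
have FL c x y i : F (c *: x + y) i = c * F x i + F y i.
  by rewrite /F gmulDr gmulZr hcomp_lin gmulDl gmulZl fL.
have Ffin x : finite_set [set i | F x i != 0].
  apply: sub_finite_set (finite_row_support x eD) => i /=; apply: contra_neq => ex.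
  by rewrite /F ex hcomp0 gmul0l functional0.
have PhiL : linear_on setT Phi.
  move=> c x y _ _; rewrite /Phi (fsum_morph (phi := fun z => c * z)) ?mulr0 //.
  - rewrite -fsumD //; first by apply: eq_fsbigr => i _; apply: FL.
    apply: sub_finite_set (Ffin x) => i /=; apply: contra_neq => ->.
    by rewrite mulr0.
  - by move=> u v; rewrite mulrDr.
have PhiE i x : e i ** x = x -> Phi x = f i (hcomp x (deg i) ** e (nu i)).
  move=> ex; rewrite /Phi (@fsumE _ _ [fset i]%fset).
    by rewrite big_seq_fset1 /F ex.
  move=> j; rewrite inE; apply: contraNT => ji.
  by rewrite /F -ex gr_mulA (df_orth eD) // gmul0l hcomp0 gmul0l functional0.
have PhiE' i h a b : e i ** a = a -> gr_comp A h a -> gr_comp A (deg i - h) b ->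
    b ** e (nu i) = b -> Phi (a ** b) = f i (a ** b).
  move=> ea ah bh be; rewrite (PhiE i); last by rewrite gr_mulA ea.
  rewrite hcomp_id; first by rewrite -gr_mulA be.
  by rewrite -(subrK h (deg i)) addrC; apply: gr_comp_mul.
have [B BE] := exists_form_of PhiL; exists B; split.
  by move=> a b c; rewrite !BE gr_mulA.
exists nu; split=> //.
  move=> i j; split=> [[_ [_ [[a _ <-] [b _ <-]]]]|->].
    rewrite BE; apply: contraNeq => jnu.
    rewrite (PhiE i); last by rewrite !gr_mulA (df_idem eD).
    rewrite !gr_mulA (hcomp_mul0r _ _ (e0 j)) -gr_mulA (df_orth eD) //.
    by rewrite gmul0r functional0.
  have [_ fl _] := fP i.
  have [b [bd be fb]] := fl 0 (e i) (e0 i) (df_idem eD i) ((elimN eqP) (df_neq0 eD i)).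
  exists (e i), b; split.
  - by exists (e i); rewrite // (df_idem eD).
  - by exists b.
  - by rewrite BE (PhiE' i 0) ?(df_idem eD) //; apply/eqP.
exists deg => i j.
have [_ fl fr] := fP i.
have Bd : form_of_degree (peirce e i j) (peirce e j (nu i)) B (deg i).
  move=> h k v w [/(peirceP eD)[ev _] vh] [_ wk]; apply: contraNeq => hk.
  rewrite BE (PhiE i); last by rewrite gr_mulA ev.
  by rewrite (hcomp_neq (gr_comp_mul vh wk)) 1?eq_sym // gmul0l functional0.
have BV h v : peirce e i j v -> gr_comp A h v -> v <> 0 ->
    exists w, [/\ peirce e j (nu i) w, gr_comp A (deg i - h) w & B v w <> 0].
  move=> /(peirceP eD)[ev ve] vh v0; have [b [bd be fb]] := fl h v vh ev v0.
  exists (e j ** b); split.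
  - by apply/(peirceP eD); rewrite -!gr_mulA be gr_mulA (df_idem eD).
  - exact: gr_comp_mul0l.
  - by rewrite BE gr_mulA ve (PhiE' i h).
have BW h w : peirce e j (nu i) w -> gr_comp A h w -> w <> 0 ->
    exists v, [/\ peirce e i j v, gr_comp A (deg i - h) v & B v w <> 0].
  move=> /(peirceP eD)[ew we] wh w0; have [a [ad ea fa]] := fr h w wh we w0.
  exists (a ** e j); split.
  - by apply/(peirceP eD); rewrite gr_mulA ea -gr_mulA (df_idem eD).
  - exact: gr_comp_mul0r.
  - by rewrite BE -gr_mulA ew (PhiE' i (deg i - h)) ?subKr.
have fd k h l : fin_dim (peirce e k l `&` gr_comp A h).
  by rewrite -(peirce_compE eD); apply: (wb_lfd e_wb).
have Bl := biscalar_linearl B; have Br := biscalar_linearr B.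
split=> //; split.
  apply: (homogeneous_pairing_dual (d := deg i)) => //; try exact: peirce_subspace.
  - by move=> h v; apply: peirce_hcomp.
  - by move=> h w; apply: peirce_hcomp.
apply: (homogeneous_pairing_dual (B := fun w v => B v w) (d := deg i)) => //;
  try exact: peirce_subspace.
- by move=> h v; apply: peirce_hcomp.
- by move=> h w; apply: peirce_hcomp.
- by move=> h k w v wP vP; rewrite addrC; apply: Bd.
Qed.

(** In the local algebra [e_i A_0 e_i] the unit [e_i] is the sum of the
    [e_i f_j e_i], so one of them is invertible. It yields an idempotent of
    [f_j A_0 f_j] equivalent to [e_i]; by locality this idempotent is [f_j]. *)
Lemma weakly_basic_idem_equiv (I J : choiceType) (e : I -> A) (f : J -> A) i :
  weakly_basic_family e -> weakly_basic_family f ->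
  exists j, idem_equiv (e i) (f j).
Proof.
move=> e_wb f_wb.
have eD := wb_distinguished e_wb; have fD := wb_distinguished f_wb.
have eloc : forall i, is_local (corner e i) := wb_local e_wb.
have floc : forall j, is_local (corner f j) := wb_local f_wb.
have [e0 f0] := (df_deg0 eD, df_deg0 fD).
have efe j : corner e i (e i ** f j ** e i).
  apply/(peirce_compP eD); split; first by do 2!apply: gr_comp_mul0r => //.
    by rewrite !gr_mulA (df_idem eD).
  by rewrite -!gr_mulA (df_idem eD).
have [j jrad] : exists j, ~ corner_rad e i (e i ** f j ** e i).
  apply: contrapT => none; apply: (rad_idem eD eloc (i := i)).
  have [Y _ eE] := row_sumE fD (e i).
  rewrite -(df_idem eD i) {2}eE gmul_sumr; apply: subspace_sum.
    exact: rad_subspace.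
  by move=> j _; rewrite gr_mulA; apply: contrapT => jrad; apply: none; exists j.
have [y [/(peirce_compP eD)[y0 ey ye] yl yr]] := corner_inverse eD eloc (efe j) jrad.
pose u := e i ** f j; pose v := f j ** e i ** y.
have uv : u ** v = e i by rewrite /u /v !gr_mulA -(gr_mulA (e i)) (df_idem fD).
have uf : u ** f j = u by rewrite /u -gr_mulA (df_idem fD).
have ve : v ** e i = v by rewrite /v -gr_mulA ye.
exists j, u, v; split=> //.
  split; first exact: gr_comp_mul0r.
  by do 2!apply: gr_comp_mul0l => //.
have fv : f j ** v = v by rewrite /v !gr_mulA (df_idem fD).
have u0 : gr_comp A 0 u by exact: gr_comp_mul0r.
have v0 : gr_comp A 0 v by do 2!apply: gr_comp_mul0l => //.
have [] // := @corner_idempotent _ _ _ _ _ fD floc j (v ** u).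
- apply/(peirce_compP fD); split; first exact: gr_comp_mul0l.
    by rewrite gr_mulA fv.
  by rewrite -gr_mulA uf.
- by rewrite -gr_mulA (gr_mulA u) uv gr_mulA ve.
move=> vu0; move/eqP: (df_neq0 eD i); case.
by rewrite -(df_idem eD i) -{1}uv -{1}uv -gr_mulA (gr_mulA v) vu0 gmul0l gmul0r.
Qed.

Lemma frobenius_family_independent (I J : choiceType) (e : I -> A) (f : J -> A) :
  weakly_basic_family e -> weakly_basic_family f ->
  frobenius_family e -> frobenius_family f.
Proof.
move=> e_wb f_wb [dp pd]; split=> j.
  have [i fe] := weakly_basic_idem_equiv j f_wb e_wb; have [k ek] := dp i.
  have [l el] := weakly_basic_idem_equiv k e_wb f_wb.
  by exists l; apply: dual_pair_equiv el ek; apply: idem_equiv_sym.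
have [k fe] := weakly_basic_idem_equiv j f_wb e_wb; have [i ek] := pd k.
have [l el] := weakly_basic_idem_equiv i e_wb f_wb.
by exists l; apply: dual_pair_equiv el _ ek; apply: idem_equiv_sym.
Qed.

Lemma graded_pseudo_FrobeniusP (I : choiceType) (e : I -> A) :
  weakly_basic_family e -> graded_pseudo_Frobenius A <-> frobenius_family e.
Proof.
move=> e_wb; split=> [[J [f [f_wb [B BN]]]]|eF]; last first.
  by exists I, e; split=> //; apply: frobenius_family_nakayama_form.
apply: (frobenius_family_independent f_wb e_wb).
exact: nakayama_form_frobenius_family (wb_distinguished f_wb) BN.
Qed.

End FrobeniusFamily.

(** * Orthogonal idempotents with local units *)

Section Families.
Context (K : fieldType) (H : zmodType) (A : grAlgebra K H).
Context (T : choiceType) (f : T -> A).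
Hypotheses (f_idem : forall t, f t ** f t = f t).
Hypotheses (f_orth : forall s t, s != t -> f s ** f t = 0).

Lemma orthogonal_rows_direct :
  (forall a, exists Y : {fset T}, a = \sum_(t <- Y) f t ** a) -> direct_sum (eA f).
Proof.
move=> f_sum a; have [Y aE] := f_sum a.
have fY t : f t ** a != 0 -> t \in Y.
  apply: contraNT => tY; rewrite aE gmul_sumr big_seq big1 // => s sY.
  by rewrite gr_mulA f_orth ?gmul0l //; apply: contraNneq tY => ->.
exists (fun t => f t ** a); split.
  split; [by move=> t; exists a| |by rewrite (fsumE fY)].
  by apply: sub_finite_set (finite_fset Y) => t; apply: fY.
move=> g [gP /finsupp_fset[Z gZ] ->]; apply: funext => t.
have fg s : f s ** g s = g s by have [b _ <-] := gP s; rewrite gr_mulA f_idem.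
rewrite (fsumE gZ) gmul_sumr.
rewrite (sum_fset_single (r := t)) ?fg // => [s st|tZ].
  by rewrite -fg gr_mulA f_orth ?gmul0l // eq_sym.
by apply/eqP; apply: contraNT tZ => /gZ.
Qed.

Lemma orthogonal_cols_direct :
  (forall a, exists Y : {fset T}, a = \sum_(t <- Y) a ** f t) -> direct_sum (Ae f).
Proof.
move=> f_sum a; have [Y aE] := f_sum a.
have fY t : a ** f t != 0 -> t \in Y.
  apply: contraNT => tY; rewrite aE gmul_suml big_seq big1 // => s sY.
  by rewrite -gr_mulA f_orth ?gmul0r //; apply: contraNneq tY => <-.
exists (fun t => a ** f t); split.
  split; [by move=> t; exists a| |by rewrite (fsumE fY)].
  by apply: sub_finite_set (finite_fset Y) => t; apply: fY.
move=> g [gP /finsupp_fset[Z gZ] ->]; apply: funext => t.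
have fg s : g s ** f s = g s by have [b _ <-] := gP s; rewrite -gr_mulA f_idem.
rewrite (fsumE gZ) gmul_suml.
rewrite (sum_fset_single (r := t)) ?fg // => [s st|tZ].
  by rewrite -fg -gr_mulA f_orth ?gmul0r.
by apply/eqP; apply: contraNT tZ => /gZ.
Qed.

End Families.

(** * The radical in degree zero *)

Section DegreeZeroRadical.
Context (K : fieldType) (H : zmodType) (A : grAlgebra K H).
Context (I : choiceType) (e : I -> A) (e_wb : weakly_basic_family e).
Implicit Types (a b c m p x : A) (i j k : I).

Let eD := wb_distinguished e_wb.
Let e_local : forall i, is_local (corner e i) := wb_local e_wb.

(** This is the Jacobson radical of [A_0]; the off-diagonal blocks are
    unconstrained since they lie in the graded radical of [A]. *)
Definition radical0 : set A :=
  [set m | gr_comp A 0 m /\ forall j, corner_rad e j (e j ** m ** e j)].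

Lemma radical0_subspace : subspace radical0.
Proof.
have [h0 hL] := @gr_comp_subspace _ _ A 0; split=> [|c x y [x0 xr] [y0 yr]].
  split=> // j; rewrite gmul0r gmul0l.
  by have [] := rad_subspace e_local j.
split=> [|j]; first exact: hL.
rewrite gmulDr gmulZr gmulDl gmulZl.
by have [_ rL] := rad_subspace e_local j; apply: rL.
Qed.

Lemma peirce_comp_corner i j h a : gr_comp A h a ->
  peirce_comp e i h j (e i ** a ** e j).
Proof. by exists a. Qed.

(** A return path from [i] through another object [k] is in the radical of the
    local algebra at [i]; through [i] itself it is as soon as [b] is. *)
Lemma corner_rad_through i k a b h : gr_comp A (- h) a -> gr_comp A h b ->
  (i = k -> corner_rad e i (e i ** b ** e i)) -> 
  (i = k -> h = 0) -> corner_rad e i (e i ** (a ** e k ** b) ** e i).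
Proof.
move=> ah bh br h0.
have -> : e i ** (a ** e k ** b) ** e i = (e i ** a ** e k) ** (e k ** b ** e i).
  by rewrite -{1}(df_idem eD k) !gr_mulA.
have [ik|ki] := eqVneq i k; last first.
  rewrite eq_sym in ki; apply: (peirce_jacobson_rad eD e_local (wb_radical e_wb ki)).
    exact: peirce_comp_corner bh.
  exact: peirce_comp_corner.
rewrite -ik; apply: (radMl e_local) (br ik).
by have := peirce_comp_corner i i ah; rewrite (h0 ik) oppr0.
Qed.

Lemma radical0Mr m r : radical0 m -> gr_comp A 0 r -> radical0 (m ** r).
Proof.
move=> [m0 mr] r0; split; first exact: gr_comp_mul0r.
move=> j; have [Y _ mE] := col_sumE eD m.
rewrite mE gmul_suml gmul_sumr gmul_suml.
apply: subspace_sum; first exact: rad_subspace.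
move=> k _.
have -> : e j ** (m ** e k ** r) ** e j = (e j ** m ** e k) ** (e k ** r ** e j).
  by rewrite -{1}(df_idem eD k) !gr_mulA.
have [<-|kj] := eqVneq j k.
  by apply: (radMr eD e_local) => //; apply: peirce_comp_corner.
rewrite eq_sym in kj; apply: (peirce_jacobson_rad eD e_local (h := 0) (wb_radical e_wb kj)).
  exact: peirce_comp_corner.
by rewrite oppr0; apply: peirce_comp_corner.
Qed.

(** A form of Nakayama's lemma, by eliminating one after the other the finitely
    many objects [k] in the support of [p]: since [e_k - e_k m e_k] is
    invertible, [p e_k] is expressed by the other components of [p]. *)
Lemma radical0_fixed p m : radical0 m -> p ** m = p -> p = 0.
Proof.
suff main (s : seq I) : forall p m, (forall i, i \notin s -> p ** e i = 0) ->
    radical0 m -> p ** m = p -> p = 0.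
  by move=> mJ pm; have [Y pY _] := col_sumE eD p; apply: (main Y) mJ pm.
elim: s => [|k s IH] {}p {}m ps mJ pm.
  by apply: contrapT => /(col_neq0 eD)[i]; case; apply: ps.
have Js := radical0_subspace; have [m0 mr] := mJ; have e0 := df_deg0 eD k.
pose q := p - p ** e k.
have kk : corner e k (e k - e k ** m ** e k).
  apply: subspaceB; [exact: peirce_comp_subspace|exact: peirce_comp_idem|].
  exact: peirce_comp_corner.
have [|y [/(peirce_compP eD)[y0 ey ye] _ yr]] := corner_inverse eD e_local kk.
  by apply: (rad_complement eD e_local) => //; rewrite subKr.
have pk : p ** e k = q ** (m ** y).
  have E : p ** e k ** (e k - e k ** m ** e k) = q ** m ** e k.
    rewrite /q gmulBr !gmulBl pm -!gr_mulA (df_idem eD) !gr_mulA.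
    by rewrite -(gr_mulA p (e k) (e k)) (df_idem eD).
  have := congr1 (fun z => z ** y) E.
  by rewrite -gr_mulA yr -gr_mulA (df_idem eD) -!gr_mulA ey.
have cJ : radical0 (m ** y) by apply: radical0Mr.
pose m' := m - m ** e k.
have m'J : radical0 m' by apply: subspaceB => //; apply: radical0Mr.
have qE : q ** (m' + m ** y ** m') = q.
  rewrite gmulDr gr_mulA -pk -gmulDl /m' gmulBr gr_mulA.
  by rewrite /q subrK pm.
have q0 : q = 0.
  apply: IH qE => [i iS|].
    have [->|ik] := eqVneq i k; first by rewrite /q gmulBl -gr_mulA (df_idem eD) subrr.
    rewrite /q gmulBl ps ?inE ?negb_or ?ik // -gr_mulA (df_orth eD) ?gmul0r ?subrr //.
    by rewrite eq_sym.
  apply: subspaceD => //; apply: radical0Mr => //.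
  by case: m'J.
by rewrite -[p](subrK (p ** e k)) -/q pk q0 gmul0l addr0.
Qed.

End DegreeZeroRadical.

(** * Lifting elements of the orbit algebra *)

Section OrbitLift.
Context (K : fieldType) (H : zmodType) (A : grAlgebra K H).
Context (I : choiceType) (e : I -> A) (G : groupType) (X : graded_action e G).
Hypotheses (eD : distinguished_family e) (X_free : acts_freely X).
Implicit Types (a b c : A) (g : G) (h d : H) (i j k : I).

Local Notation Lam := (orbit_algebra eD X_free).
Local Notation tm := (twisted_mul X).

(** The class map, with values in the graded algebra instead of its carrier. *)
Definition cls a : Lam := orbit_class X a.

Lemma clsP (c : K) a b : cls (c *: a + b) = c *: cls a + cls b.
Proof. exact: (linearP (orbit_class X)). Qed.

Lemma cls_is_linear : linear cls. Proof. exact: clsP. Qed.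

HB.instance Definition _ := GRing.isLinear.Build K A Lam _ cls cls_is_linear.

Lemma clsM a b : cls a ** cls b = cls (tm a b).
Proof. exact: (orbit_mulE eD X_free). Qed.

Lemma cls_act g a : cls (gact X g a) = cls a.
Proof. exact: orbit_class_act. Qed.

Lemma cls_surj (x : Lam) : exists a, x = cls a.
Proof. exact: orbit_class_surj. Qed.

Lemma cls_comp h a : gr_comp A h a -> gr_comp Lam h (cls a).
Proof. by move=> ah; exists a. Qed.

(** The component [e_[i] Lam] is canonically a copy of [e_i A]; [row_lift i x] is
    the element of [e_i A] representing [e_[i] x]. *)
Definition row_lift i (x : Lam) : A := tm (e i) (repr (x : orbit_space X)).

Lemma row_lift_cls i a : row_lift i (cls a) = tm (e i) a.
Proof.
apply/eqP; rewrite -subr_eq0 -scaleN1r addrC -(twisted_mul_linr eD X_free).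
rewrite (twisted_mul_nullr eD X_free) // scaleN1r addrC.
by apply/orbit_classP; rewrite /orbit_class reprK.
Qed.

Lemma tm_mull a b c : a ** tm b c = tm (a ** b) c.
Proof.
rewrite /twisted_mul (fsum_morph (phi := gr_mul A a)) ?gmul0r //.
- by apply: eq_fsbigr => g _; rewrite gr_mulA.
- by move=> x y; rewrite gmulDr.
- exact: twisted_mul_fin.
Qed.

Lemma tm_fset a b : exists Y : {fset G}, tm a b = a ** (\sum_(g <- Y) gact X g b).
Proof.
have [Y YP] := finsupp_fset (twisted_mul_fin eD X_free a b); exists Y.
by rewrite gmul_sumr -(fsumE YP).
Qed.

Lemma tm_mulr a b c : tm a b ** c = \sum_(g \in setT) a ** gact X g b ** c.
Proof.
rewrite /twisted_mul (fsum_morph (phi := fun x => x ** c)) ?gmul0l //.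
- by move=> x y; rewrite gmulDl.
- exact: twisted_mul_fin.
Qed.

Lemma gobj_inj g g' k : gobj X g k = gobj X g' k -> g = g'.
Proof. exact: (gobj_free eD X_free). Qed.

(** By freeness the [e_(g k)] are distinct, so that right multiplication by one of
    them isolates a single term of the twisted product. *)
Lemma tm_col a b k g : b ** e k = b -> tm a b ** e (gobj X g k) = a ** gact X g b.
Proof.
move=> be; rewrite tm_mulr (@fsumE _ _ [fset g]%fset).
  by rewrite big_seq_fset1 -gr_mulA -gact_e -gact_mul be.
move=> g'; rewrite inE; apply: contraNT => gg'.
rewrite -be gact_mul gact_e -!gr_mulA (df_orth eD) ?gmul0r //.
by apply: contra_neq gg' => /gobj_inj.
Qed.

Lemma tm_row a b k g : a ** e (gobj X g k) = a -> e k ** b = b ->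
  tm a b = a ** gact X g b.
Proof.
move=> ae eb; rewrite /twisted_mul (@fsumE _ _ [fset g]%fset) ?big_seq_fset1 //.
move=> g'; rewrite inE; apply: contraNT => gg'.
rewrite -ae -eb gact_mul gact_e gr_mulA -(gr_mulA a) (df_orth eD) ?gmul0r ?gmul0l //.
by rewrite eq_sym; apply: contra_neq gg' => /gobj_inj.
Qed.

Lemma tm_row1 a b k : a ** e k = a -> e k ** b = b -> tm a b = a ** b.
Proof. by move=> ae eb; rewrite (@tm_row _ _ k 1%g) ?(gobj1 X eD) // gact1. Qed.

Lemma tm_comp h d a b : gr_comp A h a -> gr_comp A d b -> gr_comp A (h + d) (tm a b).
Proof.
move=> ah bd; apply: fsum_gr_comp => g.
by apply: gr_comp_mul => //; apply: gact_comp.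
Qed.

Lemma row_lift_row i x : e i ** row_lift i x = row_lift i x.
Proof. by rewrite tm_mull (df_idem eD). Qed.

Lemma row_lift_linear i (c : K) x y : row_lift i (c *: x + y) = c *: row_lift i x + row_lift i y.
Proof.
have [a ->] := cls_surj x; have [b ->] := cls_surj y.
by rewrite -clsP !row_lift_cls (twisted_mul_linr eD X_free).
Qed.

Lemma row_lift0 i : row_lift i 0 = 0.
Proof.
have := row_lift_linear i 1 0 0; rewrite !scale1r addr0 => /esym/eqP.
by rewrite -subr_eq0 addrK => /eqP.
Qed.

Lemma cls_lift i x : cls (row_lift i x) = cls (e i) ** x.
Proof. by have [a ->] := cls_surj x; rewrite row_lift_cls clsM. Qed.

Lemma row_lift_id i a : e i ** a = a -> row_lift i (cls a) = a.
Proof. by move=> ea; rewrite row_lift_cls (@tm_row1 _ _ i) ?(df_idem eD). Qed.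

Lemma row_lift_mul i x b : row_lift i (x ** cls b) = tm (row_lift i x) b.
Proof.
have [a ->] := cls_surj x.
by rewrite clsM !row_lift_cls (twisted_mulA eD X_free).
Qed.

Lemma row_lift_comp i h x : gr_comp Lam h x -> gr_comp A h (row_lift i x).
Proof.
move=> [a ah <-]; rewrite [X in gr_comp _ _ X]row_lift_cls -[h]add0r.
by apply: tm_comp => //; apply: (df_deg0 eD).
Qed.

Lemma row_lift_neq0 i x : cls (e i) ** x = x -> x <> 0 -> row_lift i x <> 0.
Proof. by move=> ex x0 l0; apply: x0; rewrite -ex -cls_lift l0 linear0. Qed.

Lemma cls_row i a : e i ** a = a -> cls (e i) ** cls a = cls a.
Proof. by move=> ea; rewrite -cls_lift row_lift_id. Qed.

Lemma cls_col k a : a ** e k = a -> cls a ** cls (e k) = cls a.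
Proof. by move=> ae; rewrite clsM (@tm_row1 _ _ k) ?(df_idem eD) // ae. Qed.

Lemma cls_e_act g i : cls (e (gobj X g i)) = cls (e i).
Proof. by rewrite -gact_e cls_act. Qed.

Lemma cls_e_orth i k : (forall g, gobj X g k <> i) -> cls (e i) ** cls (e k) = 0.
Proof.
move=> ik; rewrite clsM /twisted_mul fsbig1 ?linear0 // => g _.
by rewrite gact_e (df_orth eD) //; apply/eqP => /esym; apply: ik.
Qed.

(** Twisted multiplication by [e_k] on the right does not factor through classes,
    so there is no counterpart of [row_lift] for columns. A representative in
    [A e_k] is obtained by moving each component in [A e_(g k)] back with the
    inverse of [g]. *)
Lemma col_representative k h y : gr_comp Lam h y -> y ** cls (e k) = y ->
  exists b, [/\ gr_comp A h b, b ** e k = b & cls b = y].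
Proof.
move=> [c ch <-] cE.
have [Y YP] := finsupp_fset (twisted_mul_fin eD X_free c (e k)).
exists (\sum_(g <- Y) gact X g^-1%g (c ** e (gobj X g k))); split.
- apply: subspace_sum => [|g _]; first exact: gr_comp_subspace.
  by apply/gact_comp/gr_comp_mul0r => //; apply: (df_deg0 eD).
- rewrite gmul_suml; apply: eq_bigr => g _.
  rewrite -[e k in LHS](gact1 X) -(mulVg g) gactM -gact_mul gact_e.
  by rewrite -gr_mulA (df_idem eD).
- rewrite linear_sum -[RHS]cE [RHS]clsM /twisted_mul (fsumE YP) linear_sum.
  by apply: eq_bigr => g _; rewrite -gact_e /=; apply: cls_act.
Qed.

Lemma cls_col_neq0 k b : b ** e k = b -> b <> 0 -> cls b <> 0.
Proof.
move=> be b0 cb; have [j jb] := row_neq0 eD b0; apply: jb.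
have := row_lift_cls j b; rewrite cb row_lift0 => /(congr1 (fun z => z ** e k)).
by rewrite gmul0l -[in e k](gobj1 X eD k) (tm_col _ _ be) gact1.
Qed.

End OrbitLift.

(** * The orbit algebra is weakly basic *)

Section OrbitFamily.
Context (K : fieldType) (H : zmodType) (A : grAlgebra K H).
Context (I : choiceType) (e : I -> A) (e_wb : weakly_basic_family e).
Context (A_bounded : graded_locally_bounded e).
Context (G : groupType) (X : graded_action e G) (X_free : acts_freely X).
Implicit Types (a b c : A) (g : G) (h d : H) (i j k : I).

Let eD := wb_distinguished e_wb.
Let e_local : forall i, is_local (corner e i) := wb_local e_wb.
Local Notation Lam := (orbit_algebra eD X_free).
Local Notation tm := (twisted_mul X).
Local Notation cls := (cls eD X_free).

Definition same_orbit i : pred I := [pred j | `[< exists g, gobj X g i = j >]].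

Lemma same_orbit_ex i : exists j, same_orbit i j.
Proof. by exists i; apply/asboolP; exists 1%g; apply: (gobj1 X eD). Qed.

Definition orbit_rep i : I := xchoose (same_orbit_ex i).

Lemma orbit_repP i : exists g, gobj X g i = orbit_rep i.
Proof. exact/asboolP/(xchooseP (same_orbit_ex i)). Qed.

Lemma orbit_rep_act g i : orbit_rep (gobj X g i) = orbit_rep i.
Proof.
apply: eq_xchoose => j; apply/asboolP/asboolP => -[g' <-].
  by exists (g' * g)%g; rewrite (gobjM X eD).
by exists (g' * g^-1)%g; rewrite -(gobjM X eD) -mulgA mulVg mulg1.
Qed.

(** One representative is chosen in each orbit of objects. *)
Definition orbit_index : Type := {i : I | orbit_rep i == i}.
HB.instance Definition _ := Choice.on orbit_index.

Definition orbit_family (t : orbit_index) : Lam := cls (e (val t)).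

Lemma orbit_indexP i : exists (t : orbit_index) g, gobj X g i = val t.
Proof.
have [g gi] := orbit_repP i.
have rr : orbit_rep (orbit_rep i) == orbit_rep i by rewrite -{1}gi orbit_rep_act.
by exists (exist (fun i => is_true (orbit_rep i == i)) _ rr), g.
Qed.

Lemma orbit_index_inj (s t : orbit_index) g : gobj X g (val s) = val t -> s = t.
Proof.
move=> gst; apply: val_inj; rewrite -(eqP (valP s)) -(eqP (valP t)) -gst.
by rewrite orbit_rep_act.
Qed.

Lemma cls_family i : exists t, cls (e i) = orbit_family t.
Proof.
by have [t [g gi]] := orbit_indexP i; exists t; rewrite /orbit_family -gi cls_e_act.
Qed.

Lemma orbit_family_orth s t : s != t -> orbit_family s ** orbit_family t = 0.
Proof.
by move=> st; apply: cls_e_orth => g /orbit_index_inj ts; rewrite ts eqxx in st.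
Qed.

Lemma orbit_family_idem t : orbit_family t ** orbit_family t = orbit_family t.
Proof. by apply: cls_row; rewrite (df_idem eD). Qed.

Lemma orbit_distinguished : distinguished_family orbit_family.
Proof.
have /choice[rep repP] := cls_family.
split.
- move=> t; apply/eqP; apply: (cls_col_neq0 (df_idem eD _)).
  by apply/eqP; apply: (df_neq0 eD).
- by move=> t; apply: cls_comp; apply: (df_deg0 eD).
- exact: orbit_family_idem.
- exact: orbit_family_orth.
- apply: (orthogonal_rows_direct orbit_family_idem orbit_family_orth) => x.
  have [a ->] := cls_surj x; have [Z _ aE] := row_sumE eD a.
  exists [fset rep i | i in Z]%fset.
  have clsE : cls a = \sum_(i <- Z) cls (e i ** a) by rewrite {1}aE linear_sum.
  rewrite clsE; under [RHS]eq_bigr => t _ do rewrite gmul_sumr.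
  rewrite exchange_big big_seq [RHS]big_seq; apply: eq_bigr => i iZ.
  have eiE : cls (e i ** a) = orbit_family (rep i) ** cls (e i ** a).
    by rewrite -repP cls_row // gr_mulA (df_idem eD).
  rewrite (sum_fset_single (r := rep i)) // => [t ti|/negP[]].
    by rewrite eiE gr_mulA orbit_family_orth ?gmul0l.
  by apply/imfsetP; exists i.
- apply: (orthogonal_cols_direct orbit_family_idem orbit_family_orth) => x.
  have [a ->] := cls_surj x; have [Z _ aE] := col_sumE eD a.
  exists [fset rep i | i in Z]%fset.
  have clsE : cls a = \sum_(i <- Z) cls (a ** e i) by rewrite {1}aE linear_sum.
  rewrite clsE; under [RHS]eq_bigr => t _ do rewrite gmul_suml.
  rewrite exchange_big big_seq [RHS]big_seq; apply: eq_bigr => i iZ.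
  have eiE : cls (a ** e i) = cls (a ** e i) ** orbit_family (rep i).
    by rewrite -repP cls_col // -gr_mulA (df_idem eD).
  rewrite (sum_fset_single (r := rep i)) // => [t ti|/negP[]].
    by rewrite eiE -gr_mulA orbit_family_orth ?gmul0r // eq_sym.
  by apply/imfsetP; exists i.
Qed.

Let fD := orbit_distinguished.

Lemma row_lift_col (s t : orbit_index) x : x ** orbit_family t = x ->
  row_lift (val s) x = tm (row_lift (val s) x) (e (val t)).
Proof. by move=> xt; rewrite -{1}xt row_lift_mul. Qed.

Lemma cls_lift_family t x : orbit_family t ** x = x -> cls (row_lift (val t) x) = x.
Proof. by move=> tx; rewrite cls_lift. Qed.

(** Lifting to [e_s A_h], the space is the sum of the [e_s A_h e_j] for [j] in the
    orbit of [t]; by local boundedness only finitely many of them are non-zero. *)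
Lemma orbit_locally_finite : locally_finite_dimensional orbit_family.
Proof.
move=> s h t; pose S := [set j | peirce_comp e (val s) h j <> [set 0]].
have Sfin : finite_set S by have [_ /(_ (val s) h)[]] := A_bounded.
have [Y0 Y0P] := finsupp_fset Sfin.
pose Y := [fset j in Y0 | `[< exists g, gobj X g (val t) = j >]]%fset.
have := fin_dim_sum (fset_uniq Y) (peirce_comp_subspace eD (val s) h)
   (fun j => peirce_comp_fin_dim e_wb (val s) h j).
move=> /(fin_dim_image cls).
congr fin_dim; apply/seteqP; split=> x.
  move=> [_ [F FP <-] <-]; rewrite linear_sum; apply: subspace_sum.
    exact: (peirce_comp_subspace fD).
  move=> j; rewrite !inE => /andP[_ /asboolP[g gj]].
  have /(peirce_compP eD)[Fh Fs Fj] := FP j.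
  apply/(peirce_compP fD); split; first exact: cls_comp.
    by rewrite cls_row.
  by rewrite /= -[orbit_family t](cls_e_act _ _ g) gj cls_col.
move=> /(peirce_compP fD)[xh xs xt].
have aE := row_lift_col s xt; set a := row_lift (val s) x in aE.
have es : e (val s) ** a = a by apply: row_lift_row.
have ah : gr_comp A h a by apply: row_lift_comp.
exists a; last by apply: cls_lift_family.
exists (fun j => a ** e j) => [j|].
  apply/(peirce_compP eD); rewrite gr_mulA es -gr_mulA (df_idem eD).
  by split=> //; apply: gr_comp_mul0r => //; apply: (df_deg0 eD).
have [Z aZ aE'] := col_sumE eD a.
transitivity (\sum_(j \in setT) a ** e j); last first.
  by rewrite [RHS]aE'; apply: fsumE => j; apply: contraNT => /aZ ->.
apply/esym/fsumE => j aj; rewrite !inE; apply/andP; split.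
  apply: Y0P => S0; move/negP: aj; apply; apply/eqP.
  suff : [set 0] (a ** e j) by [].
  rewrite -S0; apply/(peirce_compP eD); rewrite gr_mulA es -gr_mulA (df_idem eD).
  by split=> //; apply: gr_comp_mul0r => //; apply: (df_deg0 eD).
apply/asboolP; apply: contrapT => none; move/negP: aj; apply; apply/eqP.
rewrite aE (tm_mulr eD X_free) fsbig1 // => g _.
rewrite gact_e -gr_mulA (df_orth eD) ?gmul0r //.
by apply/eqP => gj; apply: none; exists g.
Qed.

(** The prospective maximal ideal of the local algebra at [t]: components at
    [e_(g t)] for [g <> 1] are unconstrained. *)
Definition diag_rad (t : orbit_index) : set Lam :=
  [set x | corner orbit_family t x /\
     corner_rad e (val t) (e (val t) ** row_lift (val t) x ** e (val t))].

Lemma corner_lift t x : corner orbit_family t x ->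
  [/\ gr_comp A 0 (row_lift (val t) x), e (val t) ** row_lift (val t) x = row_lift (val t) x
    & cls (row_lift (val t) x) = x].
Proof.
move=> /(peirce_compP fD)[x0 ex _]; split; first exact: row_lift_comp.
  exact: row_lift_row.
exact: cls_lift_family.
Qed.

Lemma row_lift_family t : row_lift (val t) (orbit_family t) = e (val t).
Proof. by apply: row_lift_id; rewrite (df_idem eD). Qed.

(** The component at [e_i] of a twisted product is a sum of return paths from [i]
    through the objects [g k], to each of which [corner_rad_through] applies. *)
Lemma corner_rad_tm i k h a b : gr_comp A (- h) a -> gr_comp A h b ->
  e k ** b = b -> (k = i -> h = 0) -> (k = i -> corner_rad e i (e i ** b ** e i)) ->
  (forall g, gobj X g k = i -> k = i) ->
  corner_rad e i (e i ** tm a b ** e i).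
Proof.
move=> ah bh eb h0 br gk.
rewrite (tm_mull eD X_free) (tm_mulr eD X_free); apply: fsum_subspace => [|g]; first exact: rad_subspace.
have -> : e i ** a ** gact X g b = e i ** (a ** e (gobj X g k) ** gact X g b).
  by rewrite -{1}eb gact_mul gact_e !gr_mulA.
have gi : i = gobj X g k -> g = 1%g /\ k = i.
  move=> ig; have ki := gk g (esym ig); split=> //.
  by apply: (gobj_inj eD X_free (k := k)); rewrite -ig (gobj1 X eD).
apply: (corner_rad_through e_wb ah (gact_comp X g bh)).
  by move=> /gi[-> ki]; rewrite gact1; apply: br.
by move=> /gi[_ /h0].
Qed.

Lemma diag_rad_left_ideal t : left_ideal (corner orbit_family t) (diag_rad t).
Proof.
have [r0 rL] := rad_subspace e_local (val t).
have [c0 cL] := peirce_comp_subspace fD t 0 t.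
split=> [|x [] //|y x yC [xC xr]].
  split=> [|c x y [xC xr] [yC yr]].
    by split=> //; rewrite row_lift0 gmul0r gmul0l.
  split; first exact: cL.
  by rewrite row_lift_linear gmulDr gmulZr gmulDl gmulZl; apply: rL.
have [a0 ea ax] := corner_lift xC; have [b0 _ _] := corner_lift yC.
split; first exact: (cornerM fD).
rewrite -{1}ax row_lift_mul; apply: (@corner_rad_tm _ (val t) 0) => //.
  by rewrite oppr0.
Qed.

Lemma diag_rad_unit t : ~ diag_rad t (orbit_family t).
Proof.
by move=> [_]; rewrite row_lift_family !(df_idem eD); apply: (rad_idem eD e_local).
Qed.

Lemma peirce_comp_act g i h j a : peirce_comp e i h j a ->
  peirce_comp e (gobj X g i) h (gobj X g j) (gact X g a).
Proof.
move=> /(peirce_compP eD)[ah ea ae]; apply/(peirce_compP eD).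
split; first exact: gact_comp.
  by rewrite -gact_e -gact_mul ea.
by rewrite -gact_e -gact_mul ae.
Qed.

Lemma corner_rad_act g i x :
  corner_rad e i x -> corner_rad e (gobj X g i) (gact X g x).
Proof.
move=> xr; have xC := rad_corner e_local xr.
apply: contrapT => /(corner_inverse eD e_local (peirce_comp_act g xC))[y [yC yx _]].
apply: (rad_idem eD e_local (i := i)).
have <- : gact X g^-1%g y ** x = e i.
  rewrite -[x](gact1 X) -(mulVg g) gactM -gact_mul yx gact_e.
  by rewrite -(gobjM X eD) mulVg (gobj1 X eD).
apply: (radMl e_local) xr; have := peirce_comp_act g^-1%g yC.
by rewrite -(gobjM X eD) mulVg (gobj1 X eD).
Qed.

Lemma radical0_act g m : radical0 e m -> radical0 e (gact X g m).
Proof.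
move=> [m0 mr]; split=> [|j]; first exact: gact_comp.
have := corner_rad_act g (mr (gobj X g^-1%g j)).
by rewrite !gact_mul !gact_e -(gobjM X eD) mulgV (gobj1 X eD).
Qed.

(** After normalization the element is [z = e_t - n], with [n] lifting to an
    element [m] of the radical of [A_0].
    Right multiplication by [z] is injective, because a fixed point of
    right multiplication by [n] is fixed by the sum of the conjugates of [m];
    hence it is onto the finite dimensional local algebra. *)
Lemma diag_rad_inverse t x : corner orbit_family t x -> ~ diag_rad t x ->
  exists2 y, corner orbit_family t y & y ** x = orbit_family t.
Proof.
move=> xC xr; have [a0 ea ax] := corner_lift xC.
set i := val t in a0 ea ax *; set a := row_lift i x in a0 ea ax *.
have aC : corner e i (e i ** a ** e i) by apply: peirce_comp_corner.
have [|u [/(peirce_compP eD)[u0 eu ue] ua _]] := corner_inverse eD e_local aC.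
  by move=> ar; apply: xr.
have uC : corner orbit_family t (cls u).
  apply/(peirce_compP fD); split; first exact: cls_comp.
    by rewrite cls_row.
  by rewrite cls_col.
pose z := cls u ** x; have zC : corner orbit_family t z by apply: (cornerM fD).
have liftz : row_lift i z = u ** a.
  by rewrite /z -ax row_lift_mul row_lift_id // (@tm_row1 _ _ _ _ _ _ _ eD X_free _ _ i).
pose m := e i - u ** a.
have mJ : radical0 e m.
  split.
    apply: subspaceB; [exact: gr_comp_subspace|exact: (df_deg0 eD)|].
    by rewrite -[0]addr0; apply: gr_comp_mul.
  move=> j; have [->|ji] := eqVneq j i.
    rewrite /m gmulBr gmulBl !(df_idem eD) gr_mulA eu -ue -!gr_mulA.
    rewrite (gr_mulA (e i) a) ua subrr.
    by case: (rad_subspace e_local i).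
  rewrite /m gmulBr (df_orth eD) // gr_mulA -eu gr_mulA (df_orth eD) //.
  by rewrite !gmul0l subrr gmul0l; case: (rad_subspace e_local j).
have [] := @fin_dim_injective_surjective _ _ (corner orbit_family t)
   (fun y => y ** z) (peirce_comp_subspace fD t 0 t) (orbit_locally_finite t 0 t)
   _ _ _ (orbit_family t) (peirce_comp_idem fD t).
- by move=> y yC; apply: (cornerM fD).
- by move=> c y y'; rewrite gmulDl gmulZl.
- move=> y yC yz; have [b0 eb by_] := corner_lift yC.
  rewrite -by_; set b := row_lift (val t) y in b0 eb by_ *.
  suff -> : b = 0 by rewrite linear0.
  have bm : tm b m = b.
    have bt : tm b (e i) = b by rewrite -row_lift_mul -/(orbit_family t) (corner_ur fD yC).
    have [_ _ cz] := corner_lift zC.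
    have bz : tm b (u ** a) = 0 by rewrite -liftz -row_lift_mul cz yz row_lift0.
    by rewrite /m addrC -scaleN1r (twisted_mul_linr eD X_free) bt bz scaler0 add0r.
  have [Y mY] := tm_fset eD X_free b m.
  apply: (radical0_fixed e_wb (m := \sum_(g <- Y) gact X g m)).
    apply: subspace_sum => [|g _]; first exact: radical0_subspace.
    exact: radical0_act.
  by rewrite -mY.
move=> y yC yz; exists (y ** cls u); first exact: (cornerM fD).
by rewrite -gr_mulA.
Qed.

Lemma orbit_local t : is_local (corner orbit_family t).
Proof.
apply: (is_local_of_left_inverse (peirce_comp_idem fD t) (@corner_ur _ _ _ _ _ fD t)
  (diag_rad_left_ideal t) (@diag_rad_unit t)).
by move=> x xC xr; apply: diag_rad_inverse.
Qed.

Lemma orbit_weakly_basic : weakly_basic_family orbit_family.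
Proof.
split; [exact: fD|exact: orbit_locally_finite|exact: orbit_local|].
move=> s t st; apply: (rad_peirce_jacobson fD orbit_local) => h x y xP yP.
have diag : diag_rad t `<=` corner_rad orbit_family t.
  exact: (local_radical_max (peirce_comp_idem fD t) (@corner_ur _ _ _ _ _ fD t) (orbit_local t)
    (diag_rad_left_ideal t) (@diag_rad_unit t)).
apply: diag.
split; first by have := peirce_comp_mul fD yP xP; rewrite addNr.
have /(peirce_compP fD)[xh ex _] := xP; have /(peirce_compP fD)[yh _ _] := yP.
rewrite -(cls_lift_family ex) row_lift_mul.
have ts : val s = val t -> False by move=> /val_inj E; rewrite E eqxx in st.
apply: (@corner_rad_tm _ (val s) h) => //.
- exact: row_lift_comp.
- exact: row_lift_comp.
- exact: row_lift_row.
- by move=> g /orbit_index_inj E; rewrite E eqxx in st.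
Qed.

End OrbitFamily.

(** * Dual pairs in an algebra and in its orbit algebra *)

Section Transfer.
Context (K : fieldType) (H : zmodType) (A : grAlgebra K H).
Context (I : choiceType) (e : I -> A).
Context (G : groupType) (X : graded_action e G).
Implicit Types (a b c : A) (g : G) (h d : H) (i j k : I).

Lemma dual_pair_act g i k : distinguished_family e ->
  dual_pair (e i) (e k) -> dual_pair (e (gobj X g i)) (e (gobj X g k)).
Proof.
move=> eD [d [f [fL fl fr]]].
have gVK a : gact X g^-1%g (gact X g a) = a by rewrite -gactM mulVg gact1.
have eV j : gact X g^-1%g (e (gobj X g j)) = e j by rewrite -gact_e gVK.
have gV0 a : a <> 0 -> gact X g^-1%g a <> 0.
  by move=> a0 ga; apply: a0; rewrite -(gactK X g a) ga gact0.
exists d, (fun x => f (gact X g^-1%g x)); split.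
- by move=> c x y _ _; rewrite linearP fL.
- move=> h a ah ea a0.
  have [| |b [bh be fb]] := fl h (gact X g^-1%g a) (gact_comp X _ ah).
  + by rewrite -(eV i) -gact_mul ea.
  + exact: gV0.
  exists (gact X g b); split; first exact: gact_comp.
    by rewrite -gact_e -gact_mul be.
  by rewrite gact_mul gVK.
- move=> h b bh be b0.
  have [| |a [ah ea fa]] := fr h (gact X g^-1%g b) (gact_comp X _ bh).
  + by rewrite -(eV k) -gact_mul be.
  + exact: gV0.
  exists (gact X g a); split; first exact: gact_comp.
    by rewrite -gact_e -gact_mul ea.
  by rewrite gact_mul gVK.
Qed.

Hypotheses (eD : distinguished_family e) (X_free : acts_freely X).
Local Notation Lam := (orbit_algebra eD X_free).
Local Notation cls := (cls eD X_free).

(** The functional on [Lam] is read off on the component [e_i A e_k] of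
    [e_[i] Lam e_[k]], the sum of the [e_i A e_(g k)]. *)
Lemma dual_pair_orbit i k :
  dual_pair (e i) (e k) -> dual_pair (cls (e i)) (cls (e k)).
Proof.
move=> [d [f [fL fl fr]]].
have f_col x b : b ** e k = b ->
    f (row_lift i (x ** cls b) ** e k) = f (row_lift i x ** b).
  move=> be; rewrite row_lift_mul -[in e k](gobj1 X eD k) (tm_col eD X_free) //.
  by rewrite gact1.
exists d, (fun x => f (row_lift i x ** e k)); split.
- by move=> c x y _ _; rewrite row_lift_linear gmulDl gmulZl fL.
- move=> h x xh ex x0.
  have [||b [bh be fb]] := fl h (row_lift i x) (row_lift_comp _ xh).
  + exact: row_lift_row.
  + exact: row_lift_neq0.
  exists (cls b); split; [exact: cls_comp|exact: cls_col|].
  by rewrite f_col.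
- move=> h y yh ye y0; have [b [bh be by_]] := col_representative yh ye.
  have [//||a [ah ea fa]] := fr h b bh.
    by move=> b0; apply: y0; rewrite -by_ b0 linear0.
  exists (cls a); split; [exact: cls_comp|exact: cls_row|].
  by rewrite -by_ f_col // row_lift_id.
Qed.

(** Some component [w0] of the element [w] of the orbit algebra is non-zero,
    and the factorizations of [w] restrict to factorizations of [w0]. *)
Lemma socle_pair_orbit i k : (forall h j, fin_dim (peirce_comp e i h j)) ->
  socle_pair (cls (e i)) (cls (e k)) ->
  exists g, dual_pair (e i) (e (gobj X g k)).
Proof.
move=> fd [d [w [[wd ew we] w0 wl wr]]].
have lw0 : row_lift i w <> 0 by apply: row_lift_neq0.
have lwE : row_lift i w = \sum_(g \in setT) row_lift i w ** e (gobj X g k).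
  rewrite -{1}we row_lift_mul /twisted_mul.
  by apply: eq_fsbigr => g _; rewrite gact_e.
have [g wg] : exists g, row_lift i w ** e (gobj X g k) <> 0.
  apply: contrapT => none; apply: lw0; rewrite lwE fsbig1 // => g _.
  by apply: contrapT => wg; apply: none; exists g.
exists g; set k' := gobj X g k in wg *; set w' := row_lift i w ** e k' in wg *.
have lwd := row_lift_comp i wd.
have w'P : peirce_comp e i d k' w'.
  apply/(peirce_compP eD); rewrite gr_mulA row_lift_row -gr_mulA (df_idem eD).
  by split=> //; apply: gr_comp_mul0r => //; apply: (df_deg0 eD).
have zs : subspace [set 0 : A].
  by split=> // c x y -> ->; rewrite scaler0 addr0.
have [f [fL _ fw]] := functional_separation (peirce_comp_subspace eD i d k')
  (fd d k') zs w'P wg.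
have /(peirce_compP eD)[_ ew' w'e] := w'P.
have fw' : f (e i ** hcomp w' d ** e k') <> 0.
  rewrite hcomp_id ?ew' ?w'e //; apply: gr_comp_mul0r => //; exact: (df_deg0 eD).
exists d, (fun x => f (e i ** hcomp x d ** e k')); split.
- move=> c x y _ _; rewrite hcomp_lin gmulDr gmulZr gmulDl gmulZl fL //.
  + by exists (hcomp x d) => //; apply: hcomp_in.
  + by exists (hcomp y d) => //; apply: hcomp_in.
- move=> h a ah ea a0.
  have [| |y [yh ye ay]] := wl h (cls a) (cls_comp _ _ ah).
  + exact: cls_row.
  + by move=> ca; apply: a0; rewrite -[a](row_lift_id eD X_free ea) ca row_lift0.
  have [b [bh be by_]] := col_representative yh ye.
  exists (gact X g b); split; first exact: gact_comp.
    by rewrite -gact_e -gact_mul be.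
  suff -> : a ** gact X g b = w' by [].
  rewrite /w' -ay -by_ row_lift_mul row_lift_id //.
  by rewrite (tm_col eD X_free).
- move=> h b bh be b0.
  have bV : cls b = cls (gact X g^-1%g b) by rewrite cls_act.
  have be' : gact X g^-1%g b ** e k = gact X g^-1%g b.
    by rewrite -[in RHS]be gact_mul gact_e -(gobjM X eD) mulVg (gobj1 X eD).
  have [| |x [xh ex xb]] := wr h (cls b) (cls_comp _ _ bh).
  + by rewrite bV cls_col.
  + exact: (cls_col_neq0 be).
  exists (row_lift i x); split; [exact: row_lift_comp|exact: row_lift_row|].
  suff -> : row_lift i x ** b = w' by [].
  rewrite /w' -xb bV row_lift_mul (tm_col eD X_free) //.
  by rewrite gactK.
Qed.

End Transfer.

Theorem theorem4p7 (K : fieldType) (H : zmodType) (A : grAlgebra K H)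
  (I : choiceType) (e : I -> A) (e_wb : weakly_basic_family e)
  (e_split : split_family e) (A_bounded : graded_locally_bounded e)
  (G : groupType) (X : graded_action e G) (X_free : acts_freely X) :
  graded_pseudo_Frobenius A <->
  graded_pseudo_Frobenius (orbit_algebra (wb_distinguished e_wb) X_free).
Proof.
have eD := wb_distinguished e_wb.
have f_wb := orbit_weakly_basic e_wb A_bounded X_free.
rewrite (graded_pseudo_FrobeniusP e_wb) (graded_pseudo_FrobeniusP f_wb).
have fE := cls_family e_wb X_free.
split=> -[dp pd]; split=> [s|s].
- have [k /(dual_pair_orbit (wb_distinguished e_wb) X_free)] := dp (val s).
  by have [t ->] := fE k; exists t.
- have [i /(dual_pair_orbit (wb_distinguished e_wb) X_free)] := pd (val s).
  by have [t ->] := fE i; exists t.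
- have [t sE] := fE s; have [u /(dual_pair_socle f_wb)] := dp t.
  rewrite -sE => /socle_pair_orbit[h j|g sg].
    exact: wb_lfd e_wb s h j.
  by exists (gobj X g (val u)).
- have [t sE] := fE s; have [u /(dual_pair_socle f_wb)] := pd t.
  rewrite -sE => /socle_pair_orbit[h j|g sg].
    exact: wb_lfd e_wb _ h j.
  exists (gobj X g^-1%g (val u)).
  have := dual_pair_act X g^-1%g eD sg.
  by rewrite -(gobjM X eD) mulVg (gobj1 X eD).
Qed.
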